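(* Let $1<p<\infty$ and $s\in\mathbb{R}$. The function $$u(x_1,x_2,t)=\Big(\frac{p}{p-1}\Big)^{p-1}t+|x_1|^{1+\frac{1}{p-1}}$$ is a solution to the parabolic $p$-Laplace equation $u_t-\operatorname{div}(|Du|^{p-2}Du)=0$ in $\mathbb{R}^2\times(0,\infty)$, and $$\big|D\big(|Du|^{\frac{p-2+s}{2}}Du\big)\big|=C(p,s)\,|x_1|^{\frac{-p+2+s}{2(p-1)}}\in L^2_{\mathrm{loc}}(\mathbb{R}^2\times(0,\infty))\quad\text{if and only if}\quad s>-1,$$ where $C(p,s)$ is a constant depending only on $p$ and $s$. That is, the displayed identity holds, and the quantity in it belongs to $L^2_{\mathrm{loc}}(\mathbb{R}^2\times(0,\infty))$ if and only if $s>-1$. This counterexample shows that the range $s>-1$ is sharp in the second order regularity theorem stated in the context.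
   Context: $D$ denotes the gradient (for vector fields, the matrix of first-order derivatives) with respect to the space variables only. For $s\in\mathbb{R}$, $V_s:\mathbb{R}^n\to\mathbb{R}^n$ is defined by $V_s(z)=|z|^{\frac{p-2+s}{2}}z$ for $z\neq 0$ and $V_s(0)=0$, so that $|Du|^{\frac{p-2+s}{2}}Du=V_s(Du)$. Weak solution: let $\Omega\subset\mathbb{R}^n$ be an open domain and $\Omega_T=\Omega\times(0,T)$. A function $u$ is a weak solution of $u_t-\operatorname{div}(|Du|^{p-2}Du)=0$ in $\Omega_T$ if for every open cylinder $U\times(t_1,t_2)$ whose closure is a compact subset of $\Omega_T$ one has $u\in C(U\times(t_1,t_2))\cap L^p(t_1,t_2;W^{1,p}(U))$, and $$\int_0^T\int_{\Omega}|Du|^{p-2}\langle Du,D\phi\rangle\,dx\,dt-\int_0^T\int_{\Omega}u\,\phi_t\,dx\,dt=0\quad\text{for all }\phi\in C_0^\infty(\Omega_T).$$ For $\mathbb{R}^2\times(0,\infty)$, take $\Omega=\mathbb{R}^2$ and $T=\infty$. Second order regularity theorem whose range is shown to be sharp: let $1<p<\infty$ and let $u:\Omega_T\to\mathbb{R}$ be a weak solution of $u_t-\operatorname{div}(|Du|^{p-2}Du)=0$ in $\Omega_T$. If $s>-1$, then $D(V_s(Du))$ exists and belongs to $L^2_{\mathrm{loc}}(\Omega_T)$. Moreover, $$\int_{Q_r}|D(V_s(Du))|^2\,dx\,dt\le\frac{C}{r^2}\Big(\int_{Q_{2r}}|V_s(Du)|^2\,dx\,dt+\int_{Q_{2r}}|Du|^{s+2}\,dx\,dt\Big),$$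 where $C=C(p,s)>0$ and $Q_r\subset Q_{2r}$ are concentric parabolic cylinders with $Q_{2r}$ compactly contained in $\Omega_T$. Here $Q_r=B_r(x_0)\times(t_0-r^2,t_0+r^2)$ and $B_r(x_0)$ is the Euclidean ball of radius $r$ centred at $x_0$.
   Formalization: For s = -p one has C(p,s) = 0, so the displayed function is 0 and lies in L^2_loc though s < -1; the equivalence for C(p,s)|x_1|^(...) is therefore proved for s ≠ -p, and for all s with D(V_s(Du)) as a weak derivative; the identity holds off x_1 = 0. *)

(* Defs.v *)
From HB Require Import structures.
From mathcomp Require Import all_boot all_order all_algebra.
From mathcomp Require Import all_classical all_reals all_analysis.

Set Implicit Arguments.
Unset Strict Implicit.
Unset Printing Implicit Defensive.

Import Order.TTheory GRing.Theory Num.Theory.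
Import numFieldNormedType.Exports.

Local Open Scope classical_set_scope.
Local Open Scope ring_scope.

(* A space point is a pair x = (x_1, x_2) and a space-time point is a pair
   z = (x, t), because the library's product measures live on product types;
   measurableTypeR R is R with its Borel sets.  Values of vector and matrix
   fields are 'rV[R]_2 and 'M[R]_2.  The library norms on products and matrices
   are max norms; the Euclidean ones are enorm and frobenius below. *)

Notation xspace R := (measurableTypeR R * measurableTypeR R)%type.
Notation xtspace R :=
  (measurableTypeR R * measurableTypeR R * measurableTypeR R)%type.

Section Calculus.
Context {R : realType}.
Implicit Types (z : xtspace R).

Definition leb1 : {measure set (measurableTypeR R) -> \bar R} :=
  lebesgue_measure.

Definition leb2 : {measure set (xspace R) -> \bar R} :=
  (@lebesgue_measure R \x @lebesgue_measure R)%E.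

Definition leb3 : {measure set (xtspace R) -> \bar R} :=
  ((@lebesgue_measure R \x @lebesgue_measure R) \x @lebesgue_measure R)%E.

Definition dot (v w : 'rV[R]_2) : R := \sum_i v 0 i * w 0 i.

Definition enorm (v : 'rV[R]_2) : R := Num.sqrt (dot v v).

Definition frobenius (A : 'M[R]_2) : R :=
  Num.sqrt (\sum_i \sum_j A i j ^+ 2).

Definition xdir (i : 'I_2) : xspace R := ((i == 0)%:R, (i == 1)%:R).

Definition sdir (i : 'I_2) : xtspace R := (xdir i, 0).

Definition tdir : xtspace R := (0, 1).

Definition sgrad (f : xtspace R -> R) z : 'rV[R]_2 :=
  \row_i 'D_(sdir i) f z.

Definition sjac (F : xtspace R -> 'rV[R]_2) z : 'M[R]_2 :=
  \matrix_(i, j) 'D_(sdir j) (fun y => F y 0 i) z.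

Fixpoint Ck (V : normedModType R) (k : nat) (f : V -> R) : Prop :=
  if k is k'.+1 then
    (forall y : V, differentiable f y) /\ (forall v, Ck k' ('D_v f))
  else continuous f.

Definition cylinder (U : set (xspace R)) (t1 t2 : R) : set (xtspace R) :=
  U `*` `]t1, t2[.

(* C_0^oo(O), each function being extended by 0 outside O *)
Definition test_function (V : normedModType R) (O : set V) (phi : V -> R) :=
  (forall k, Ck k phi) /\
  exists K : set V,
    [/\ compact K, K `<=` O & forall y : V, ~ K y -> phi y = 0].

Definition Lp d (T : measurableType d) (mu : {measure set T -> \bar R})
    (q : R) (O : set T) (f : T -> R) : Prop :=
  measurable_fun O f /\ (\int[mu]_(x in O) (`|f x| `^ q)%:E < +oo)%E.

Definition Lp_loc (q : R) (O : set (xtspace R)) (f : xtspace R -> R) :=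
  measurable_fun O f /\
  forall K, compact K -> K `<=` O ->
    (\int[leb3]_(z in K) (`|f z| `^ q)%:E < +oo)%E.

(* f belongs to W^{1,q}(U) and its weak gradient is g *)
Definition W1p (q : R) (U : set (xspace R)) (f : xspace R -> R)
    (g : xspace R -> 'rV[R]_2) : Prop :=
  [/\ Lp leb2 q U f,
      forall i, Lp leb2 q U (fun x => g x 0 i) &
      forall i psi, test_function U psi ->
        (\int[leb2]_(x in U) (f x * 'D_(xdir i) psi x)%:E =
         - \int[leb2]_(x in U) (g x 0 i * psi x)%:E)%E].

(* u belongs to L^q(t1, t2; W^{1,q}(U)) and Du is its weak space gradient.
   Strong measurability of t |-> u(., t) is expressed by joint measurability
   of u and of Du. *)
Definition Lp_W1p (q : R) (U : set (xspace R)) (t1 t2 : R)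
    (u : xtspace R -> R) (Du : xtspace R -> 'rV[R]_2) : Prop :=
  [/\ measurable_fun (cylinder U t1 t2) u,
      forall i, measurable_fun (cylinder U t1 t2) (fun z => Du z 0 i),
      {ae leb1, forall t, t1 < t < t2 ->
        W1p q U (fun x => u (x, t)) (fun x => Du (x, t))} &
      (\int[leb1]_(t in `]t1, t2[) \int[leb2]_(x in U)
        (`|u (x, t)| `^ q + enorm (Du (x, t)) `^ q)%:E < +oo)%E].

(* F is locally integrable in O and W is its weak Jacobian matrix with
   respect to the space variables *)
Definition weak_sjac (O : set (xtspace R))
    (F : xtspace R -> 'rV[R]_2) (W : xtspace R -> 'M[R]_2) : Prop :=
  [/\ forall i, Lp_loc 1 O (fun z => F z 0 i),
      forall i j, Lp_loc 1 O (fun z => W z i j) &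
      forall i j phi, test_function O phi ->
        (\int[leb3]_(z in O) (F z 0 i * 'D_(sdir j) phi z)%:E =
         - \int[leb3]_(z in O) (W z i j * phi z)%:E)%E].

(* "the space derivative of F exists and belongs to L^2_loc(O)" *)
Definition sjac_in_L2loc (O : set (xtspace R))
    (F : xtspace R -> 'rV[R]_2) : Prop :=
  exists W, weak_sjac O F W /\ Lp_loc 2 O (fun z => frobenius (W z)).

End Calculus.

Section ParabolicPLaplace.
Context {R : realType}.

Definition time_interval (T : \bar R) : set R :=
  [set t | 0 < t /\ (t%:E < T)%E].

Definition Omega_T (Omega : set (xspace R)) (T : \bar R) : set (xtspace R) :=
  Omega `*` time_interval T.

(* u is a weak solution of u_t - div (|Du|^(p-2) Du) = 0 in Omega x (0, T), and
   Du is its weak space gradient, which u determines almost everywhere.  Where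
   Du = 0 the factor |Du|^(p-2) is multiplied by 0, so the value of 0 `^ (p - 2)
   does not matter. *)
Definition weak_solution (p : R) (Omega : set (xspace R)) (T : \bar R)
    (u : xtspace R -> R) (Du : xtspace R -> 'rV[R]_2) : Prop :=
  (forall (U : set (xspace R)) (t1 t2 : R), open U -> t1 < t2 ->
     compact (closure (cylinder U t1 t2)) ->
     closure (cylinder U t1 t2) `<=` Omega_T Omega T ->
     {within cylinder U t1 t2, continuous u} /\ Lp_W1p p U t1 t2 u Du) /\
  forall phi, test_function (Omega_T Omega T) phi ->
    (\int[leb1]_(t in time_interval T) \int[leb2]_(x in Omega)
       (enorm (Du (x, t)) `^ (p - 2)
          * dot (Du (x, t)) (sgrad phi (x, t)))%:E
     - \int[leb1]_(t in time_interval T) \int[leb2]_(x in Omega)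
       (u (x, t) * 'D_tdir phi (x, t))%:E = 0)%E.

(* |v|^((p-2+s)/2) v; it vanishes at v = 0 whatever the exponent is *)
Definition Vs (p s : R) (v : 'rV[R]_2) : 'rV[R]_2 :=
  enorm v `^ ((p - 2 + s) / 2) *: v.

(* the qualitative part of the second order regularity theorem *)
Definition second_order_regularity (p s : R) (Omega : set (xspace R))
    (T : \bar R) : Prop :=
  forall u Du, weak_solution p Omega T u Du ->
    sjac_in_L2loc (Omega_T Omega T) (fun z => Vs p s (Du z)).

Definition example_sol (p : R) (z : xtspace R) : R :=
  (p / (p - 1)) `^ (p - 1) * z.2 + `|z.1.1| `^ (1 + (p - 1)^-1).

End ParabolicPLaplace.

(* Main.v *)
Require Import Defs.
From HB Require Import structures.
From mathcomp Require Import all_boot all_order all_algebra.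
From mathcomp Require Import all_classical all_reals all_analysis.
From mathcomp Require Import measurable_realfun ring lra.

Set Implicit Arguments.
Unset Strict Implicit.
Unset Printing Implicit Defensive.

Import Order.TTheory GRing.Theory Num.Theory.
Import numFieldNormedType.Exports.

Local Open Scope classical_set_scope.
Local Open Scope ring_scope.

(** With a = 1/(p-1) the function is u = c t + |x_1|^(1+a), so every field in the
    theorem depends on x_1 alone and is a signed power spow b y = y |y|^(b-1).
    The first component of Du is (1+a) spow a x_1.  Its flux |Du|^(p-2) Du is the
    linear field c x_1, because a (p-1) = 1; the divergence of the flux is the
    time derivative c of u (flux_exampleE, weak_solution_example).  The first
    component of V_s (Du) is k spow b x_1 with b = (p+s) / (2(p-1)), and its
    x_1-derivative off the line x_1 = 0 is k b |x_1|^(b-1) (Vs_exampleE,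
    sjac_exampleE).  The threshold s > -1 is b > 1/2, that is 2(b-1) > -1: exactly
    then |x_1|^(b-1) is square integrable near the line.

    For b > 0 the classical derivative is the weak one (weak_sjac_example).  It is
    singular at x_1 = 0, but locally integrable, and spow b is continuous there,
    so that the one-dimensional integration by parts has no contribution from 0
    (integral_derive_eq0); Fubini's theorem does the rest.

    For b <= 1/2 there is no square integrable weak derivative at all
    (no_L2_weak_derivative).  Tested with a smooth bump of width e in x_1, the
    signed power gives at least a multiple of e^(1/2), while a square integrable w
    gives at most a multiple of e^(1/2) times its L^2 norm on the shrinking
    support of the bump, and this norm tends to 0.  The smooth bump is built from
    exp(-1/x). *)

(** * Signed powers of one real variable *)

Section Powers.
Context {R : realType}.
Implicit Types (b y : R).

(** The signed power sgn(y) |y|^b.  This form needs no case distinction and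
    vanishes at 0 for every b, even when |0|^(b-1) is the convention value 1. *)
Definition spow b y : R := y * `|y| `^ (b - 1).

Lemma spow0 b : spow b 0 = 0.
Proof. by rewrite /spow mul0r. Qed.

Lemma normr_spow b y : y != 0 -> `|spow b y| = `|y| `^ b.
Proof.
move=> y0; rewrite /spow normrM (ger0_norm (powR_ge0 _ _)).
rewrite -{1}[`|y|]powRr1 // -powRD; last by rewrite normr_eq0 y0 implybT.
by congr (_ `^ _); ring.
Qed.

Lemma normr_spow_le b y : `|spow b y| <= `|y| `^ b.
Proof.
have [->|y0] := eqVneq y 0; first by rewrite spow0 normr0 powR_ge0.
by rewrite normr_spow.
Qed.

Lemma is_derive_normr_powR b y : y != 0 ->
  is_derive y 1 (fun x => `|x| `^ b) (b * spow (b - 1) y).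
Proof.
move=> y0; rewrite /spow; have [yp|yn] : 0 < y \/ y < 0 by lra.
  have near_y : \near y, y `^ b = `|y| `^ b.
    by near=> x; rewrite gtr0_norm//; near: x; exact: lt_nbhsr.
  apply: near_eq_is_derive near_y _.
  have -> : b * (y * `|y| `^ (b - 1 - 1)) = b * y `^ (b - 1).
    rewrite gtr0_norm// -{1}[y]powRr1 ?ltW// -powRD ?y0 ?implybT//.
    by congr (_ * _ `^ _); ring.
  exact: is_derive1_powR.
have near_y : \near y, (- y) `^ b = `|y| `^ b.
  by near=> x; rewrite ltr0_norm//; near: x; exact: lt_nbhsl.
apply: near_eq_is_derive near_y _.
have -> : b * (y * `|y| `^ (b - 1 - 1)) = b * (- y) `^ (b - 1) * (-1).
  have y0' : - y != 0 by rewrite oppr_eq0.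
  rewrite ltr0_norm// -{1}[y]opprK -{1}[- y]powRr1 ?oppr_ge0 ?ltW//.
  rewrite mulNr -powRD ?y0' ?implybT//.
  rewrite (_ : 1 + (b - 1 - 1) = b - 1); ring.
have yp : 0 < - y by lra.
apply: (@is_derive1_comp _ (fun x => x `^ b) -%R).
exact: is_derive1_powR.
Unshelve. all: end_near. Qed.

Lemma is_derive_spow b y : y != 0 ->
  is_derive y 1 (spow b) (b * `|y| `^ (b - 1)).
Proof.
move=> y0; have d1 := is_derive_normr_powR (b - 1) y0.
have d0 := @is_derive_id R R y 1.
have dM := @is_deriveM R R id (fun x => `|x| `^ (b - 1)) y 1 _ _ d0 d1.
apply: (is_derive_eq dM); rewrite /spow /= /GRing.scale /= mulr1.
have <- : y ^+ 2 * `|y| `^ (b - 1 - 1 - 1) = `|y| `^ (b - 1).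
  rewrite -[y ^+ 2]real_normK ?num_real// -powR_mulrn// -powRD.
    by congr (_ `^ _); ring.
  by rewrite normr_eq0 y0 implybT.
by ring.
Qed.

Lemma continuous_normr_powR b : 0 < b -> continuous (fun y => `|y| `^ b).
Proof.
move=> b0 y; have [->|y0] := eqVneq y 0; last first.
  apply: differentiable_continuous; apply/derivable1_diffP.
  by have [] := is_derive_normr_powR b y0.
rewrite /continuous_at normr0 powR0 ?gt_eqF//.
apply/cvgrPdist_le => e e0; near=> x.
rewrite sub0r normrN (ger0_norm (powR_ge0 _ _)).
have -> : e = (e `^ b^-1) `^ b.
  by rewrite -powRrM mulVf ?gt_eqF// powRr1 // ltW.
apply: ge0_ler_powR; rewrite ?nnegrE ?powR_ge0 ?normr_ge0 ?(ltW b0)//.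
near: x; apply: (@nbhs0_le R R); exact: powR_gt0.
Unshelve. all: end_near. Qed.

(** At 0 the difference quotient of |y|^b is at most |y|^(b-1) in absolute value. *)
Lemma is_derive_normr_powR_gt1 b y : 1 < b ->
  is_derive y 1 (fun x => `|x| `^ b) (b * spow (b - 1) y).
Proof.
move=> b1; have [->|] := eqVneq y 0; last exact: is_derive_normr_powR.
rewrite spow0 mulr0.
suff H : h^-1 *: (`|(h *: 1 + 0 : R)| `^ b - `|(0 : R)| `^ b) @[h --> 0^'] --> (0 : R).
  by split; [apply/cvg_ex; exists 0 | apply/cvg_lim].
have b10 : 0 < b - 1 by lra.
have := continuous_normr_powR b10 (x := 0).
rewrite /continuous_at normr0 powR0 ?gt_eqF// => /cvgrPdist_le cont.
apply/cvgrPdist_le => e e0; have [d /= d0 Hd] := cont _ e0.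
exists d => //= h /= dh h0; have := Hd h dh.
rewrite !sub0r !normrN (ger0_norm (powR_ge0 _ _)); apply: le_trans.
rewrite powR0 ?subr0; last by rewrite gt_eqF//; lra.
rewrite /GRing.scale /= mulr1 addr0 normrM normfV (ger0_norm (powR_ge0 _ _)).
by rewrite powRB ?normr_eq0 ?h0 ?implybT// powRr1// mulrC lexx.
Qed.

Lemma continuous_spow b : 0 < b -> continuous (spow b).
Proof.
move=> b0 y; have [->|y0] := eqVneq y 0; last first.
  apply: differentiable_continuous; apply/derivable1_diffP.
  by have [] := is_derive_spow b y0.
have := continuous_normr_powR b0 (x := 0).
rewrite /continuous_at normr0 spow0 powR0 ?gt_eqF// => /cvgrPdist_le cont.
apply/cvgrPdist_le => e /cont; apply: filterS => x.
rewrite !sub0r !normrN (ger0_norm (powR_ge0 _ _)).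
exact/le_trans/normr_spow_le.
Qed.

Lemma continuous_normr_powR_neq0 b y : y != 0 ->
  {for y, continuous (fun x => `|x| `^ b)}.
Proof.
move=> y0; apply: differentiable_continuous; apply/derivable1_diffP.
by have [] := is_derive_normr_powR b y0.
Qed.

Lemma measurable_normr_powR b : measurable_fun [set: R] (fun y => `|y| `^ b).
Proof.
have : measurable_fun [set: R] ((fun y : R => y `^ b) \o Num.norm) by
  apply: measurableT_comp; [exact: measurable_powR | exact: normr_measurable].
exact.
Qed.

Lemma measurable_spow b : measurable_fun [set: R] (spow b).
Proof. by apply: measurable_funM => //; exact: measurable_normr_powR. Qed.

End Powers.

(** * The fundamental theorem of calculus across a singular point *)

Section FTC.
Context {R : realType}.
Implicit Types (G g : R -> R) (a b M : R).
Local Notation mu := (@lebesgue_measure R).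

(** The derivative g may be unbounded at a and b.  On the open interval G and
    the primitive x |-> int_a^x g have the same derivative, hence differ by a
    constant; integrability of g makes the primitive continuous up to the end
    points, as G is. *)
Lemma FTC2_integrable G g a b : a < b -> continuous G ->
  (forall x, a < x < b -> is_derive x 1 G (g x)) ->
  (forall x, a < x < b -> {for x, continuous g}) ->
  mu.-integrable `[a, b] (EFin \o g) ->
  \int[mu]_(x in `[a, b]) g x = G b - G a.
Proof.
move=> ab cG dG cg ig.
pose F x := parameterized_integral mu a x g.
have FG x y : a < x -> x < y -> y < b -> F y - F x = G y - G x.
  move=> ax xy yb; have aby z : x <= z <= y -> a < z < b.
    by move=> /andP[? ?]; rewrite (lt_le_trans ax)//= (le_lt_trans _ yb).
  have := @continuous_FTC2 R g G x y xy.
  rewrite /F /parameterized_integral Rintegral_itvB//; last 3 first.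
  - by apply: integrableS ig => //; apply: subset_itvl; rewrite bnd_simp ltW.
  - by rewrite bnd_simp ltW.
  - by rewrite bnd_simp ltW.
  rewrite Rintegral_itv_obnd_cbnd//; last first.
    apply: integrableS ig => //; apply: subset_itvScc; rewrite bnd_simp ltW//.
  rewrite /Rintegral => -> //.
  - apply: continuous_in_subspaceT => z.
    by rewrite inE/= in_itv/= => /aby /cg.
  - split.
    + move=> z; rewrite in_itv/= => /andP[xz zy].
      by have [] := dG z; rewrite ?(lt_trans ax) ?(lt_trans zy).
    + exact/cvg_at_right_filter/cG.
    + exact/cvg_at_left_filter/cG.
  - move=> z; rewrite in_itv/= => /andP[xz zy]; rewrite derive1E.
    by have [] := dG z; rewrite ?(lt_trans ax) ?(lt_trans zy).
pose c := (a + b) / 2.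
have [ac cb] : a < c /\ c < b by rewrite /c; split; lra.
have K x : a < x -> x < b -> F x - G x = F c - G c.
  move=> ax xb; have [xc|cx|->//] := ltgtP x c.
    by have := FG _ _ ax xc cb; lra.
  by have := FG _ _ ac cx xb; lra.
have l0 : F x - G x @[x --> a^'+] --> 0 - G a.
  apply: cvgB; last exact/cvg_at_right_filter/cG.
  exact/cvg_at_right_filter/(parameterized_integral_cvg_left ab ig).
have l1 : F x - G x @[x --> a^'+] --> F c - G c.
  apply: (@cvg_trans _ ((fun=> F c - G c) x @[x --> a^'+])); last exact: cvg_cst.
  by apply: near_eq_cvg; near=> x; rewrite K.
have r0 : F x - G x @[x --> b^'-] --> F b - G b.
  apply: cvgB; last exact/cvg_at_left_filter/cG.
  exact: (parameterized_integral_cvg_at_left ab ig).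
have r1 : F x - G x @[x --> b^'-] --> F c - G c.
  apply: (@cvg_trans _ ((fun=> F c - G c) x @[x --> b^'-])); last exact: cvg_cst.
  by apply: near_eq_cvg; near=> x; rewrite K.
have e0 := cvg_unique _ l0 l1; have e1 := cvg_unique _ r0 r1.
have {}e0 : 0 - G a = F c - G c by exact: e0.
have {}e1 : F b - G b = F c - G c by exact: e1.
rewrite -[LHS]/(F b); apply: (addIr (- G b)).
by rewrite e1 -e0 addrAC subrr.
Unshelve. all: end_near. Qed.

(** G may fail to be differentiable at 0: splitting the integral there leaves
    G(0) - G(-M) + G(M) - G(0) = 0. *)
Lemma integral_derive_eq0 G g M : 0 < M -> continuous G ->
  (forall x : R, x != 0 -> is_derive x 1 G (g x)) ->
  (forall x : R, x != 0 -> {for x, continuous g}) ->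
  mu.-integrable setT (EFin \o g) ->
  (forall x : R, M <= `|x| -> G x = 0) -> (forall x : R, M <= `|x| -> g x = 0) ->
  (\int[mu]_x (g x)%:E = 0)%E.
Proof.
move=> M0 cG dG cg ig G0 g0.
have igS (A : set R) : measurable A -> mu.-integrable A (EFin \o g).
  by move=> mA; apply: integrableS ig.
have EM : (\int[mu]_x (g x)%:E = \int[mu]_(x in `[(- M)%R, M]) (g x)%:E)%E.
  rewrite [RHS]integral_mkcond; apply: eq_integral => x _.
  rewrite patchE; case: ifPn => //; rewrite notin_setE/= in_itv/= -ler_norml.
  by move=> /negP; rewrite -ltNge => /ltW/g0 ->.
have gM : G M = 0 by apply: G0; rewrite ger0_norm// ltW.
have gNM : G (- M) = 0 by apply: G0; rewrite normrN ger0_norm// ltW.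
have I1 : \int[mu]_(x in `[- M, 0]) g x = G 0 - G (- M).
  apply: FTC2_integrable => //; rewrite ?oppr_lt0//.
  - by move=> x /andP[_ x0]; apply: dG; rewrite lt_eqF.
  - by move=> x /andP[_ x0]; apply: cg; rewrite lt_eqF.
  - exact: igS.
have I2 : \int[mu]_(x in `[0, M]) g x = G M - G 0.
  apply: FTC2_integrable => //.
  - by move=> x /andP[x0 _]; apply: dG; rewrite gt_eqF.
  - by move=> x /andP[x0 _]; apply: cg; rewrite gt_eqF.
  - exact: igS.
rewrite EM -(fineK (integrable_fin_num _ (igS `[(- M)%R, M]%classic _)))//.
have := @Rintegral_itvB R g (BLeft (- M)) (BRight M) 0.
rewrite Rintegral_itv_obnd_cbnd; [|exact: igS].
rewrite I1 I2 gM gNM bnd_simp /Rintegral => H; congr (_%:E).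
have : fine (\int[mu]_(x in `[(- M)%R, M]) (g x)%:E)%E - (G 0 - 0) = 0 - G 0.
  by apply: H; rewrite ?bnd_simp ?oppr_le0 ?ltW//; exact: igS.
by lra.
Qed.

End FTC.

(** * Integrability of powers near the origin *)

Section PowerIntegrable.
Context {R : realType}.
Local Notation mu := (@lebesgue_measure R).

(** On both sides of 0, |y|^q is the derivative of spow (q+1) / (q+1), an
    increasing odd function for q > -1. *)
Lemma integral_normr_powR_le (q M d : R) : -1 < q -> 0 < d -> d < M ->
  (\int[mu]_(y in `[(- M)%R, (- d)%R] `|` `[d, M]) (`|y| `^ q)%:E
     <= (2 * (q + 1)^-1 * M `^ (q + 1))%:E)%E.
Proof.
move=> q1 d0 dM.
have q0 : q + 1 != 0 by lra.
pose G y := (q + 1)^-1 * spow (q + 1) y.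
have dG (y : R) : y != 0 -> is_derive y 1 G (`|y| `^ q).
  move=> y0; have := is_deriveZ (q + 1)^-1 (is_derive_spow (q + 1) y0).
  move=> H; apply: (is_derive_eq H).
  by rewrite /GRing.scale /= mulrA mulVf// mul1r; congr (_ `^ _); ring.
have cG : continuous G.
  move=> y; apply: cvgM; first exact: cvg_cst.
  by apply: continuous_spow; lra.
have I (a b : R) : a < b -> 0 < a \/ b < 0 ->
    (\int[mu]_(y in `[a, b]) (`|y| `^ q)%:E = (G b - G a)%:E)%E.
  move=> ab ab0.
  have ny (y : R) : a <= y <= b -> y != 0.
    move=> /andP[ay yb]; case: ab0 => [a0|b0].
      by rewrite gt_eqF// (lt_le_trans a0).
    by rewrite lt_eqF// (le_lt_trans yb).
  rewrite (@continuous_FTC2 _ _ G)//.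
  - apply: continuous_in_subspaceT => y; rewrite inE/= in_itv/= => /ny.
    exact: continuous_normr_powR_neq0.
  - split.
    + move=> y /subset_itv_oo_cc; rewrite in_itv/= => /ny/dG.
      by case.
    + exact/cvg_at_right_filter/cG.
    + exact/cvg_at_left_filter/cG.
  - move=> y /subset_itv_oo_cc; rewrite in_itv/= => /ny/dG.
    by rewrite derive1E; case.
rewrite ge0_integral_setU//=; last 2 first.
- apply/measurable_EFinP; apply: measurable_funTS; exact: measurable_normr_powR.
- apply/disj_setPS => y [/=]; rewrite !in_itv/= => /andP[_ yd] /andP[dy _].
  have : d <= - d by exact: le_trans dy yd.
  by lra.
rewrite !I//; [|by left| |by right; lra]; last by lra.
have M0 : 0 < M by exact: lt_trans dM.
have Godd y : G (- y) = - G y by rewrite /G /spow normrN !mulNr mulrN.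
have GM : G M = (q + 1)^-1 * M `^ (q + 1).
  rewrite /G /spow gtr0_norm// addrK -{1}[M]powRr1 ?(ltW M0)//.
  by rewrite -powRD ?(gt_eqF M0) ?implybT// [1 + q]addrC.
have Gd : 0 <= G d.
  rewrite /G /spow mulr_ge0 ?invr_ge0//; first by lra.
  by rewrite mulr_ge0 ?powR_ge0// ltW.
by rewrite -EFinD lee_fin !Godd -mulrA -GM; lra.
Qed.

(** Monotone convergence along the sets where 1/(n+1) <= |y| <= M. *)
Lemma integrable_normr_powR (q M : R) : -1 < q ->
  mu.-integrable `[(- M)%R, M] (EFin \o (fun y => `|y| `^ q)).
Proof.
move=> q1; wlog M1 : M / 1 < M.
  move=> H; apply: (integrableS _ _ _ (H (`|M| + 2) _)) => //.
    move=> y /=; rewrite !in_itv/= => /andP[y1 y2].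
    by have := ler_norm M; have := ler_norm (- M); rewrite normrN; lra.
  by have := normr_ge0 M; lra.
have mf (A : set (measurableTypeR R)) : measurable A ->
    measurable_fun A (EFin \o (fun y => `|y| `^ q)).
  move=> mA; apply/measurable_EFinP; apply: measurable_funTS.
  exact: measurable_normr_powR.
apply/integrableP; split; first exact: mf.
under eq_integral do rewrite /= ger0_norm ?powR_ge0//.
pose F n := `[(- M)%R, (- n.+1%:R^-1)%R] `|` `[n.+1%:R^-1, M] : set R.
have UF : `[(- M)%R, M] `\ 0 = \bigcup_n F n.
  apply/seteqP; split=> [y /= []|y [n _]]; rewrite /F /= ?in_itv/=.
    move=> yM y0; have y0' : 0 < `|y| by rewrite normr_gt0; exact/eqP.
    have [n _ /(_ n (leqnn _)) Hn] := near_infty_natSinv_lt (PosNum y0').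
    exists n => //; rewrite /F/= !in_itv/=; have /= := Hn; move: yM.
    set e := n.+1%:R^-1; case: (ger0P y) => y1 /andP[? ?] ?.
      by right; lra.
    by left; lra.
  have n0 : 0 < n.+1%:R^-1 :> R by rewrite invr_gt0.
  set e := n.+1%:R^-1 in n0 *.
  by case=> /andP[? ?]; split; [lra|move=> y0; lra|lra|move=> y0; lra].
rewrite -(@integral_setD1 _ _ 0); last 2 first.
- by apply: measurableD.
- by apply: mf; exact: measurableD.
rewrite UF.
have := @ge0_nondecreasing_set_cvg_integral _ (measurableTypeR R) R F
  (EFin \o (fun y : R => `|y| `^ q)) mu.
have mF n : measurable (F n) by apply: measurableU.
have Fpos i x : F i x -> (0 <= (`|x| `^ q)%R%:E)%E.
  by rewrite lee_fin powR_ge0.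
have ndF : nondecreasing_seq F.
  move=> n m nm; apply/subsetPset => y; rewrite /F/= !in_itv/=.
  have : m.+1%:R^-1 <= n.+1%:R^-1 :> R by rewrite lef_pV2 ?posrE// ler_nat.
  set e := n.+1%:R^-1; set e' := m.+1%:R^-1 => ee.
  by case=> /andP[? ?]; [left|right]; lra.
move=> /(_ ndF mF (fun n => mf _ (mF n)) Fpos) cvgF.
rewrite -(cvg_lim _ cvgF)//.
apply: (@le_lt_trans _ _ (2 * (q + 1)^-1 * M `^ (q + 1))%:E); last exact: ltry.
apply: lime_le; first by apply/cvg_ex; eexists; exact: cvgF.
apply: nearW => n; apply: integral_normr_powR_le => //.
apply: le_lt_trans M1; rewrite invf_le1// ler1n//.
Qed.

End PowerIntegrable.

(** * Borel sets of the plane and of space-time *)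

(** A topological product carries the product sigma-algebra of its factors; the
    two structures are linked only through a countable family of measurable
    sets that contains a basis of neighborhoods, a property that passes to
    products.  The neighborhoods are a parameter because they are not part of a
    measurable type. *)
Definition measurably_based (d : measure_display) (T : measurableType d)
    (nb : T -> set (set T)) : Prop :=
  exists B : nat -> set T, (forall n, measurable (B n)) /\
    forall x A, nb x A -> exists n, B n x /\ B n `<=` A.

Section Based.
Context {R : realType}.

Lemma measurably_based_open d (T : measurableType d) nb (A : set T) :
  measurably_based nb -> (forall x, A x -> nb x A) -> measurable A.
Proof.
move=> [B [mB HB]] nA.
rewrite (_ : A = \bigcup_(n in [set n | B n `<=` A]) B n).
  by apply: bigcup_measurable => n _.
apply/seteqP; split=> [x Ax|x [n /= nA' Bx]]; last exact: nA'.
by have [n [Bx BA]] := HB x A (nA x Ax); exists n.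
Qed.

Lemma measurably_basedR : measurably_based (T := measurableTypeR R) (@nbhs _ R).
Proof.
pose B n := if @unpickle (rat * rat)%type n is Some (p, q) then
  `]ratr p, ratr q[%classic : set R else set0.
exists B; split=> [n|x A /nbhs_ballP[e /= e0 eA]].
  by rewrite /B; case: unpickle => // -[p q].
have [p] : exists p, ratr p \in `]x - e, x[.
  by apply: rat_in_itvoo; lra.
rewrite in_itv/= => /andP[p1 p2].
have [q] : exists q, ratr q \in `]x, x + e[.
  by apply: rat_in_itvoo; lra.
rewrite in_itv/= => /andP[q1 q2].
exists (pickle (p, q)); rewrite /B pickleK /= in_itv/= p2 q1; split=> // y.
rewrite /= in_itv/= => /andP[y1 y2]; apply: eA; rewrite /ball/= ltr_norml.
by lra.
Qed.

Lemma measurably_based_prod d1 d2 (T1 : measurableType d1)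
    (T2 : measurableType d2) nb1 nb2 (nb : T1 * T2 -> set (set (T1 * T2))) :
  measurably_based nb1 -> measurably_based nb2 ->
  (forall x A, nb x A ->
     exists A1 A2, [/\ nb1 x.1 A1, nb2 x.2 A2 & A1 `*` A2 `<=` A]) ->
  measurably_based nb.
Proof.
move=> [B1 [mB1 H1]] [B2 [mB2 H2]] nbE.
pose B n := if @unpickle (nat * nat)%type n is Some (p, q) then
  B1 p `*` B2 q else set0.
exists B; split=> [n|x A /nbE[A1 [A2 [/H1[p [p1 pA]] /H2[q [q1 qA]] A12]]]].
  rewrite /B; case: unpickle => // -[p q]; exact: measurableX.
exists (pickle (p, q)); rewrite /B pickleK; split=> // y [/pA y1 /qA y2].
exact: A12.
Qed.

Lemma measurably_based2 :
  measurably_based (T := (measurableTypeR R * measurableTypeR R)%type)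
    (@nbhs _ (xspace R)).
Proof.
apply: measurably_based_prod measurably_basedR measurably_basedR _.
by move=> x A [[A1 A2] /= [? ?] ?]; exists A1, A2.
Qed.

Lemma measurably_based3 :
  measurably_based (T := (xtspace R)) (@nbhs _ (xtspace R)).
Proof.
apply: measurably_based_prod measurably_based2 measurably_basedR _.
by move=> x A [[A1 A2] /= [? ?] ?]; exists A1, A2.
Qed.

Lemma open_measurable2 (A : set (xspace R)) : open A -> measurable A.
Proof.
rewrite openE => oA; apply: (measurably_based_open measurably_based2) => x.
exact: oA.
Qed.

Lemma open_measurable3 (A : set (xtspace R)) : open A -> measurable A.
Proof.
rewrite openE => oA; apply: (measurably_based_open measurably_based3) => x.
exact: oA.
Qed.

Lemma compact_measurable3 (K : set (xtspace R)) : compact K -> measurable K.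
Proof.
move=> cK; rewrite -(setCK K); apply: measurableC; apply: open_measurable3.
apply: closed_openC; apply: compact_closed => //.
Qed.

Lemma continuous_measurable2 (f : xspace R -> R) :
  continuous f -> measurable_fun setT f.
Proof.
move=> /continuousP cf; apply: (measurability _ (RGenOpens.measurableE R)).
move=> _ [_ [a [b ->] <-]]; rewrite setTI.
by apply: open_measurable2; apply: cf; exact: interval_open.
Qed.

Lemma continuous_measurable3 (f : xtspace R -> R) :
  continuous f -> measurable_fun setT f.
Proof.
move=> /continuousP cf; apply: (measurability _ (RGenOpens.measurableE R)).
move=> _ [_ [a [b ->] <-]]; rewrite setTI.
by apply: open_measurable3; apply: cf; exact: interval_open.
Qed.

End Based.

(** * Integration over products and boxes *)

Section ProductIntegrals.
Context d1 d2 (T1 : measurableType d1) (T2 : measurableType d2) {R : realType}.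
Variables (m1 : {sigma_finite_measure set T1 -> \bar R})
  (m2 : {sigma_finite_measure set T2 -> \bar R}).

Lemma integrable_prod_mul (f : T1 -> R) (g : T2 -> R) :
  m1.-integrable setT (EFin \o f) -> m2.-integrable setT (EFin \o g) ->
  (m1 \x m2)%E.-integrable setT (fun z => (f z.1 * g z.2)%:E).
Proof.
move=> /integrableP[/measurable_EFinP mf fi] /integrableP[/measurable_EFinP mg gi].
apply/integrable12ltyP.
  apply/measurable_EFinP; apply: measurable_funM.
    exact: (measurableT_comp mf).
  exact: (measurableT_comp mg).
have mag : measurable_fun setT (fun y => `|(g y)%:E|%E).
  by apply: measurableT_comp => //; exact/measurable_EFinP.
have maf : measurable_fun setT (fun y => `|(f y)%:E|%E).
  by apply: measurableT_comp => //; exact/measurable_EFinP.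
have E x : (\int[m2]_y `|(f (x, y).1 * g (x, y).2)%:E|
    = `|(f x)%:E| * \int[m2]_y `|(g y)%:E|)%E.
  by rewrite -ge0_integralZl//; apply: eq_integral => y _; rewrite -abseM.
under eq_integral do rewrite E.
rewrite ge0_integralZr//; last exact: integral_ge0.
by rewrite lte_mul_pinfty// ?integral_ge0// ge0_fin_numE// integral_ge0.
Qed.

End ProductIntegrals.

Section Boxes.
Context {R : realType}.
Implicit Types (M : R) (k : R -> R).
Local Notation mu := (@lebesgue_measure R).

(** Lebesgue measure of the plane under its own name, so that it can be registered
    as sigma-finite and be the first factor of leb3 in Fubini's theorem. *)
Definition leb2s : set (xspace R) -> \bar R := leb2.
HB.instance Definition _ := Measure.copy leb2s (leb2 : set _ -> _).
Let leb2_sigma_finite : sigma_finite setT leb2s.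
Proof.
exists (fun n => `[(- n%:R)%R, n%:R] `*` `[(- n%:R)%R, n%:R]).
  apply/seteqP; split=> // -[x y] _.
  exists (Num.truncn (`|x| + `|y|)).+1 => //=; rewrite !in_itv/= -!ler_norml.
  have := truncnS_gt (`|x| + `|y|); have := normr_ge0 x; have := normr_ge0 y.
  by move=> ? ? ?; split; apply: ltW; lra.
move=> n; split; first exact: measurableX.
have mun : (mu `[(- n%:R)%R, n%:R] < +oo)%E.
  by rewrite lebesgue_measure_itv; case: ifP => _; rewrite ?ltry// -EFinB ltry.
by rewrite /leb2s /leb2 /= product_measure1E// lte_mul_pinfty// ge0_fin_numE.
Qed.
HB.instance Definition _ := Measure_isSigmaFinite.Build _ _ _ leb2s leb2_sigma_finite.

Definition box2 M : set (xspace R) := `[- M, M] `*` `[- M, M].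
Definition box3 M : set (xtspace R) := box2 M `*` `[- M, M].

Lemma measurable_box2 M : measurable (box2 M).
Proof. exact: measurableX. Qed.

Lemma measurable_box3 M : measurable (box3 M).
Proof. by apply: measurableX => //; exact: measurable_box2. Qed.

Lemma integrable_patch M k :
  mu.-integrable `[- M, M] (EFin \o k) ->
  mu.-integrable setT (EFin \o (k \_ `[- M, M])).
Proof. by move=> ik; rewrite -restrict_EFin; apply/(integrable_mkcond _ _).1. Qed.

Lemma integrable_patch1 M :
  mu.-integrable setT (EFin \o ((cst 1 : R -> R) \_ `[- M, M])).
Proof.
apply: integrable_patch; apply: continuous_compact_integrable.
  exact: segment_compact.
by apply: continuous_subspaceT => x; exact: cvg_cst.
Qed.

(** The majorant is the tensor product of k and an indicator function.  This is
    what makes functions with a singularity on the line x_1 = 0 integrable. *)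
Lemma integrable2_le M k (f : xspace R -> R) : measurable_fun setT f ->
  mu.-integrable `[- M, M] (EFin \o k) ->
  (forall x, box2 M x -> `|f x| <= k x.1) -> (forall x, ~ box2 M x -> f x = 0) ->
  leb2.-integrable setT (EFin \o f).
Proof.
move=> mf ik fk f0.
apply: le_integrable (integrable_prod_mul (integrable_patch ik) (integrable_patch1 M)).
- by [].
- exact/measurable_EFinP.
move=> x _; rewrite /= lee_fin.
have [bx|nbx] := pselect (box2 M x); last by rewrite f0// normr0.
have [b1 b2] := bx; rewrite !patchE !mem_set// mulr1.
exact: le_trans (fk _ bx) (ler_norm _).
Qed.

Lemma integrable3_le M k (f : xtspace R -> R) : measurable_fun setT f ->
  mu.-integrable `[- M, M] (EFin \o k) ->
  (forall x, box3 M x -> `|f x| <= k x.1.1) -> (forall x, ~ box3 M x -> f x = 0) ->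
  leb3.-integrable setT (EFin \o f).
Proof.
move=> mf ik fk f0.
have i2 := integrable_prod_mul (integrable_patch ik) (integrable_patch1 M).
pose k2 (x : xspace R) :=
  (k \_ `[- M, M]) x.1 * ((cst 1 : R -> R) \_ `[- M, M]) x.2.
have i3 := integrable_prod_mul (f := k2)
  (m1 := leb2s)
  (m2 := mu) i2 (integrable_patch1 M).
apply: le_integrable i3 => //; first exact/measurable_EFinP.
move=> x _; rewrite /= lee_fin.
have [bx|nbx] := pselect (box3 M x); last by rewrite f0// normr0.
have [[b1 b2] b3] := bx; rewrite /k2 !patchE !mem_set// !mulr1.
exact: le_trans (fk _ bx) (ler_norm _).
Qed.

Lemma integral2_slice1 (f : xspace R -> R) :
  leb2.-integrable setT (EFin \o f) ->
  (forall y, \int[mu]_x (f (x, y))%:E = 0)%E -> (\int[leb2]_x (f x)%:E = 0)%E.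
Proof.
move=> fi f0; have <- := @integral21_prod_meas1 _ _ _ _ R mu mu _ fi.
by rewrite integral0_eq// => y _; exact: f0.
Qed.

Lemma integral2_slice2 (f : xspace R -> R) :
  leb2.-integrable setT (EFin \o f) ->
  (forall x, \int[mu]_y (f (x, y))%:E = 0)%E -> (\int[leb2]_x (f x)%:E = 0)%E.
Proof.
move=> fi f0; have <- := @integral12_prod_meas1 _ _ _ _ R mu mu _ fi.
by rewrite integral0_eq// => y _; exact: f0.
Qed.

Lemma integral3_iter (f : xtspace R -> R) :
  leb3.-integrable setT (EFin \o f) ->
  (\int[leb1]_t \int[leb2]_x (f (x, t))%:E = \int[leb3]_z (f z)%:E)%E.
Proof.
exact: (@integral21_prod_meas1 _ _ _ _ R leb2s mu).
Qed.

Lemma integral3_slice_x (f : xtspace R -> R) :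
  leb3.-integrable setT (EFin \o f) ->
  (forall t, \int[leb2]_x (f (x, t))%:E = 0)%E -> (\int[leb3]_z (f z)%:E = 0)%E.
Proof.
by move=> fi f0; rewrite -integral3_iter// integral0_eq// => t _; exact: f0.
Qed.

Lemma integral3_slice_t (f : xtspace R -> R) :
  leb3.-integrable setT (EFin \o f) ->
  (forall x, \int[leb1]_t (f (x, t))%:E = 0)%E -> (\int[leb3]_z (f z)%:E = 0)%E.
Proof.
move=> fi f0.
have <- := @integral12_prod_meas1 _ _ _ _ R leb2s mu _ fi.
by rewrite integral0_eq// => t _; exact: f0.
Qed.

End Boxes.

(** * Test functions *)

Section TestFunctions.
Context {R : realType}.

(** The part of smoothness that integration by parts along v needs.  Unlike
    being a test function, it is visibly inherited by the slices at fixed t. *)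
Definition C1along (V : normedModType R) (v : V) (psi : V -> R) :=
  [/\ continuous psi, forall y, derivable psi y v & continuous ('D_v psi)].

Lemma Ck_continuous (V : normedModType R) k (f : V -> R) :
  Ck k f -> continuous f.
Proof.
by case: k => [//|k] [df _] y; apply: differentiable_continuous; exact: df.
Qed.

Lemma test_function_C1along (V : normedModType R) (O : set V) v phi :
  test_function O phi -> C1along v phi.
Proof.
move=> [Ckphi _]; split; first exact: Ck_continuous (Ckphi 0).
  by move=> y; apply: diff_derivable; case: (Ckphi 1) => + _; exact.
by case: (Ckphi 1) => _ /(_ v).
Qed.

Lemma derive_off_support (V : normedModType R) (K : set V) v (phi : V -> R) y :
  closed K -> (forall x, ~ K x -> phi x = 0) -> ~ K y -> 'D_v phi y = 0.
Proof.
move=> cK phi0 nKy.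
have near0 : \near y, (fun=> 0) y = phi y.
  near=> x; rewrite phi0//; near: x.
  by apply: open_nbhs_nbhs; split; [exact: closed_openC|].
rewrite -(near_eq_derive v near0); exact: derive_cst.
Unshelve. all: end_near. Qed.

Lemma derive_off_compact (V : normedModType R) (K : set V) v (phi : V -> R) :
  compact K -> (forall x, ~ K x -> phi x = 0) ->
  forall x, ~ K x -> 'D_v phi x = 0.
Proof.
by move=> cK phi0 x; apply: derive_off_support => //; exact: compact_closed.
Qed.

Lemma compact_bounded_norm (V : normedModType R) (K : set V) :
  compact K -> exists B, forall x, K x -> `|x| <= B.
Proof.
move=> /compact_bounded[B [_ HB]]; exists (B + 1) => x Kx.
by apply: HB Kx; lra.
Qed.

Lemma compact_support_bounded (V : normedModType R) (K : set V) (f : V -> R) :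
  compact K -> continuous f -> (forall x, ~ K x -> f x = 0) ->
  exists2 B, 0 <= B & forall x, `|f x| <= B.
Proof.
move=> cK cf f0.
have /compact_bounded_norm[B HB] : compact (f @` K).
  by apply: continuous_compact => //; exact: continuous_subspaceT.
exists `|B| => // x; have [Kx|/f0->] := pselect (K x); last by rewrite normr0.
by apply: le_trans (ler_norm B); apply: HB; exists x.
Qed.

Let line_quotient (V : normedModType R) (f : V -> R) (l : R -> V) v y :
  (forall h, l (h + y) = h *: v + l y) ->
  (fun h : R => h^-1 *: ((f \o l \o shift y) (h *: 1) - (f \o l) y)) =
  (fun h : R => h^-1 *: ((f \o shift (l y)) (h *: v) - f (l y))).
Proof.
by move=> lE; apply/funext => h /=; rewrite -lE /GRing.scale /= mulr1.
Qed.

(** Directional derivatives are ordinary derivatives along an affine line l of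
    direction v. *)
Lemma is_derive_line (V : normedModType R) (f : V -> R) (l : R -> V) v y :
  (forall h, l (h + y) = h *: v + l y) -> derivable f (l y) v ->
  is_derive y 1 (f \o l) ('D_v f (l y)).
Proof.
by move=> lE df; split; rewrite ?/derivable ?/derive (line_quotient f lE).
Qed.

Lemma derive_line (V : normedModType R) (f : V -> R) (l : R -> V) v y d :
  (forall h, l (h + y) = h *: v + l y) -> is_derive y 1 (f \o l) d ->
  'D_v f (l y) = d.
Proof.
by move=> lE [_ <-]; rewrite /derive (line_quotient f lE).
Qed.

Lemma compact_coord_lt3 (K : set (xtspace R)) : compact K ->
  exists M, 0 < M /\ forall z, K z ->
    [/\ `|z.1.1| < M, `|z.1.2| < M & `|z.2| < M].
Proof.
move=> /compact_bounded_norm[B HB]; exists (`|B| + 1); split.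
  by have := normr_ge0 B; lra.
move=> z Kz; have : `|z| < `|B| + 1.
  by have := HB z Kz; have := ler_norm B; lra.
rewrite prod_normE => /(le_lt_trans _) H.
by split; apply: H; rewrite ?prod_normE !le_max lexx ?orbT.
Qed.

Lemma compact_coord_lt2 (K : set (xspace R)) : compact K ->
  exists M, 0 < M /\ forall z, K z -> `|z.1| < M /\ `|z.2| < M.
Proof.
move=> /compact_bounded_norm[B HB]; exists (`|B| + 1); split.
  by have := normr_ge0 B; lra.
move=> z Kz; have : `|z| < `|B| + 1.
  by have := HB z Kz; have := ler_norm B; lra.
rewrite prod_normE => /(le_lt_trans _) H.
by split; apply: H; rewrite ?prod_normE !le_max lexx ?orbT.
Qed.

Lemma integral_vanish d (T : measurableType d)
    (m : {measure set T -> \bar R}) (O : set T) (f : T -> R) :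
  (forall x, ~ O x -> f x = 0) ->
  (\int[m]_(x in O) (f x)%:E = \int[m]_x (f x)%:E)%E.
Proof.
move=> f0; rewrite integral_mkcond; apply: eq_integral => x _.
by rewrite patchE; case: ifPn => //; rewrite notin_setE => /f0 ->.
Qed.

End TestFunctions.

(** * Integration by parts in the plane *)

Section IntegrationByParts.
Context {R : realType}.
Local Notation mu := (@lebesgue_measure R).
Implicit Types (H g h : R -> R).

Definition locint h := measurable_fun setT h /\
  forall M, mu.-integrable `[- M, M] (EFin \o h).

Lemma continuous_locint h : continuous h -> locint h.
Proof.
move=> ch; split; first exact: continuous_measurable_fun.
move=> M; apply: continuous_compact_integrable; first exact: segment_compact.
exact: continuous_subspaceT.
Qed.

(** H is a primitive of g in the sense of distributions: g may blow up at 0, but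
    it is locally integrable, and H is continuous there. *)
Definition singular_primitive H g :=
  [/\ continuous H, forall x : R, x != 0 -> is_derive x 1 H (g x),
      forall x : R, x != 0 -> {for x, continuous g} & locint g].

Lemma integrable_locint_bound h M B : locint h ->
  mu.-integrable `[- M, M] (EFin \o (fun y => B * `|h y|)).
Proof.
move=> [_ /(_ M) ih].
by apply: eq_integrable (integrableZl _ B (integrable_norm ih)).
Qed.

Lemma integrable2_locint h (chi : xspace R -> R) K : locint h ->
  continuous chi -> compact K -> (forall x, ~ K x -> chi x = 0) ->
  leb2.-integrable setT (EFin \o (fun x => h x.1 * chi x)).
Proof.
move=> lh cchi cK chi0.
have [B B0 HB] := compact_support_bounded cK cchi chi0.
have [M [M0 KM]] := compact_coord_lt2 cK.
apply: (integrable2_le _ (integrable_locint_bound M B lh)).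
- apply: measurable_funM; last exact: continuous_measurable2.
  by apply: (measurableT_comp (proj1 lh)); exact: measurable_fst.
- by move=> x _; rewrite normrM mulrC ler_wpM2r.
- move=> x nb; rewrite chi0 ?mulr0// => /KM[x1 x2]; apply: nb; split => /=;
  by rewrite in_itv/= -ler_norml ltW.
Qed.

Lemma integrable3_locint h (chi : xtspace R -> R) K : locint h ->
  continuous chi -> compact K -> (forall x, ~ K x -> chi x = 0) ->
  leb3.-integrable setT (EFin \o (fun x => h x.1.1 * chi x)).
Proof.
move=> lh cchi cK chi0.
have [B B0 HB] := compact_support_bounded cK cchi chi0.
have [M [M0 KM]] := compact_coord_lt3 cK.
apply: (integrable3_le _ (integrable_locint_bound M B lh)).
- apply: measurable_funM; last exact: continuous_measurable3.
  apply: (measurableT_comp (proj1 lh)).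
  by apply: (measurableT_comp measurable_fst); exact: measurable_fst.
- by move=> x _; rewrite normrM mulrC ler_wpM2r.
- move=> x nb; rewrite chi0 ?mulr0// => /KM[x1 x2 x3]; apply: nb.
  by split; [split|] => /=; rewrite in_itv/= -ler_norml ltW.
Qed.

Lemma integrable1_locint h (chi : R -> R) M B : locint h ->
  continuous chi -> (forall y, `|chi y| <= B) ->
  (forall y : R, M <= `|y| -> chi y = 0) ->
  mu.-integrable setT (EFin \o (fun y => h y * chi y)).
Proof.
move=> lh cchi HB chi0.
have mf : measurable_fun setT (fun y => h y * chi y).
  apply: measurable_funM; first exact: (proj1 lh).
  exact: continuous_measurable_fun.
apply: le_integrable (integrable_patch (integrable_locint_bound M B lh)) => //.
  exact/measurable_EFinP.
move=> y _; rewrite /= lee_fin patchE; case: ifPn => [_|].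
  rewrite normrM mulrC; apply: le_trans (ler_norm _).
  by rewrite ler_wpM2r.
rewrite notin_setE/= in_itv/= -ler_norml => /negP; rewrite -ltNge => /ltW yM.
by rewrite chi0// mulr0 normr0.
Qed.

(** The product H psi is continuous with compact support, so the integral of its
    derivative vanishes although that derivative may be singular at 0. *)
Lemma integral_by_parts1 H g (psi dpsi : R -> R) M B : singular_primitive H g ->
  continuous psi -> continuous dpsi -> (forall y : R, is_derive y 1 psi (dpsi y)) ->
  (forall y, `|psi y| <= B) -> (forall y, `|dpsi y| <= B) ->
  0 < M -> (forall y : R, M <= `|y| -> psi y = 0) ->
  (forall y : R, M <= `|y| -> dpsi y = 0) ->
  (\int[mu]_y (H y * dpsi y + g y * psi y)%:E = 0)%E.
Proof.
move=> [cH dH cg lg] cpsi cdpsi dpsiE Bpsi Bdpsi M0 psi0 dpsi0.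
apply: (@integral_derive_eq0 _ (fun y => H y * psi y) _ M) => //.
- by move=> y; apply: cvgM; [exact: cH|exact: cpsi].
- move=> y y0; apply: is_derive_eq (is_deriveM (dH y y0) (dpsiE y)) _.
  by rewrite /GRing.scale /= [psi y * _]mulrC.
- move=> y y0; apply: cvgD; apply: cvgM; try exact: cH; try exact: cpsi.
    exact: cdpsi.
  exact: cg.
- have := integrableD measurableT
    (integrable1_locint (continuous_locint cH) cdpsi Bdpsi dpsi0)
    (integrable1_locint lg cpsi Bpsi psi0).
  by apply: eq_integrable.
- by move=> y yM; rewrite psi0// mulr0.
- by move=> y yM; rewrite psi0// dpsi0// !mulr0 addr0.
Qed.

Section Plane.
Variables (psi : xspace R -> R) (K : set (xspace R)).
Hypotheses (cK : compact K) (psi0 : forall x, ~ K x -> psi x = 0).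

Let Dpsi0 v x : ~ K x -> 'D_v psi x = 0.
Proof.
exact: derive_off_compact.
Qed.

Let line1 (y : R) (h x : R) : ((h + x, y) : xspace R) = h *: xdir 0 + (x, y).
Proof.
by congr pair; rewrite /= /GRing.scale /= ?mulr1 ?mulr0 ?add0r.
Qed.

Let line2 (x : R) (h y : R) : ((x, h + y) : xspace R) = h *: xdir 1 + (x, y).
Proof.
by congr pair; rewrite /= /GRing.scale /= ?mulr1 ?mulr0 ?add0r.
Qed.

Let continuous_fst_line (f : xspace R -> R) y : continuous f ->
  continuous (fun x => f (x, y)).
Proof.
move=> cf x; apply: (continuous_comp (f := fun x => (x, y))); last exact: cf.
by apply: differentiable_continuous; apply: differentiable_pair.
Qed.

Let continuous_snd_line (f : xspace R -> R) x : continuous f ->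
  continuous (fun y => f (x, y)).
Proof.
move=> cf y; apply: (continuous_comp (f := fun y => (x, y))); last exact: cf.
by apply: differentiable_continuous; apply: differentiable_pair.
Qed.

(** Fubini, integrating along x_1 first. *)
Lemma integral_by_parts2_x1 H g : singular_primitive H g ->
  C1along (xdir 0) psi ->
  (\int[leb2]_x (H x.1 * 'D_(xdir 0) psi x + g x.1 * psi x)%:E = 0)%E.
Proof.
move=> pHg [cpsi dpsi cDpsi]; have [cH _ _ lg] := pHg.
have [M [M0 KM]] := compact_coord_lt2 cK.
have [B1 _ HB1] := compact_support_bounded cK cpsi psi0.
have [B2 _ HB2] := compact_support_bounded cK cDpsi (Dpsi0 _).
have off x y : M <= `|x| -> ~ K (x, y).
  by move=> Mx /KM[] /= + _; rewrite ltNge Mx.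
apply: integral2_slice1.
  have i1 := integrable2_locint (continuous_locint cH) cDpsi cK (@Dpsi0 _).
  have i2 := integrable2_locint lg cpsi cK psi0.
  by apply: eq_integrable (integrableD measurableT i1 i2).
move=> y.
apply: (integral_by_parts1 (psi := fun x => psi (x, y)) (M := M)
  (B := Num.max B1 B2) pHg) => //.
- refine (@continuous_fst_line psi y cpsi).
- refine (@continuous_fst_line _ y cDpsi).
- by move=> x; apply: (is_derive_line (l := fun x => (x, y) : xspace R)).
- by move=> x; rewrite le_max HB1.
- by move=> x; rewrite le_max HB2 orbT.
- by move=> x /off/psi0.
- by move=> x /off/Dpsi0.
Qed.

(** Fubini, integrating along x_2 first: on each line the factor h is constant. *)
Lemma integral_by_parts2_x2 h : locint h -> C1along (xdir 1) psi ->
  (\int[leb2]_x (h x.1 * 'D_(xdir 1) psi x)%:E = 0)%E.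
Proof.
move=> lh [cpsi dpsi cDpsi].
have [M [M0 KM]] := compact_coord_lt2 cK.
have [B1 _ HB1] := compact_support_bounded cK cpsi psi0.
have [B2 _ HB2] := compact_support_bounded cK cDpsi (Dpsi0 _).
have off x y : M <= `|y| -> ~ K (x, y).
  by move=> My /KM[] /= _; rewrite ltNge My.
apply: integral2_slice2; first exact: integrable2_locint cDpsi cK (Dpsi0 _).
move=> x.
have pc : singular_primitive (fun=> h x) (fun=> 0).
  split.
  - by move=> y; exact: cvg_cst.
  - by move=> y _; exact: is_derive_cst.
  - by move=> y _; exact: cvg_cst.
  - by apply: continuous_locint => y; exact: cvg_cst.
have := integral_by_parts1 (psi := fun y => psi (x, y))
  (dpsi := fun y => 'D_(xdir 1) psi (x, y)) (M := M) (B := Num.max B1 B2) pc.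
under eq_integral do rewrite mul0r addr0.
apply => //.
- refine (@continuous_snd_line psi x cpsi).
- refine (@continuous_snd_line _ x cDpsi).
- by move=> y; apply: (is_derive_line (l := fun y => (x, y) : xspace R)).
- by move=> y; rewrite le_max HB1.
- by move=> y; rewrite le_max HB2 orbT.
- by move=> y /off/psi0.
- by move=> y /off/Dpsi0.
Qed.

End Plane.

End IntegrationByParts.

(** * Integration by parts in space-time *)

Section Space.
Context {R : realType}.
Local Notation mu := (@lebesgue_measure R).
Implicit Types (H g h : R -> R).
Variables (phi : xtspace R -> R) (K : set (xtspace R)).
Hypotheses (cK : compact K) (phi0 : forall x, ~ K x -> phi x = 0).

Let Dphi0 v x : ~ K x -> 'D_v phi x = 0.
Proof. exact: derive_off_compact. Qed.

Let quotient_slice i (t : R) (x : xspace R) :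
  (fun h : R => h^-1 *: (((fun x => phi (x, t)) \o shift x) (h *: xdir i)
     - phi (x, t))) =
  (fun h : R => h^-1 *: ((phi \o shift (x, t)) (h *: sdir i) - phi (x, t))).
Proof.
apply/funext => h /=.
by rewrite (_ : h *: sdir i + (x, t) = (h *: xdir i + x, t))//; congr pair;
  rewrite /= scaler0 add0r.
Qed.

Let derive_slice i (t : R) (x : xspace R) :
  'D_(xdir i) (fun x => phi (x, t)) x = 'D_(sdir i) phi (x, t).
Proof. by rewrite /derive quotient_slice. Qed.

Let slice_C1along i (t : R) : C1along (sdir i) phi ->
  C1along (xdir i) (fun x => phi (x, t)).
Proof.
have cp (f : xtspace R -> R) : continuous f -> continuous (fun x => f (x, t)).
  move=> cf x.
  apply: (continuous_comp (f := fun x : xspace R => (x, t) : xtspace R)); last exact: cf.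
  by apply: (@differentiable_continuous R); apply: differentiable_pair.
move=> [cphi dphi cDphi]; split; first exact: cp cphi.
- by move=> x; rewrite /derivable quotient_slice; exact: dphi.
- have -> : 'D_(xdir i) (fun x => phi (x, t)) = fun x => 'D_(sdir i) phi (x, t).
    by apply/funext => x; exact: derive_slice.
  exact: cp cDphi.
Qed.

Let slice_support t x : ~ (fst @` K) x -> phi (x, t) = 0.
Proof. by move=> nK; apply: phi0 => Kx; apply: nK; exists (x, t). Qed.

Let compact_fst_image : compact (fst @` K).
Proof.
apply: continuous_compact => //; apply: continuous_subspaceT => x.
exact: cvg_fst.
Qed.

(** For fixed t this is the planar statement for the slice phi (., t). *)
Lemma integral_by_parts3_x1 H g : singular_primitive H g ->
  C1along (sdir 0) phi ->
  [/\ leb3.-integrable setT (EFin \o (fun z => H z.1.1 * 'D_(sdir 0) phi z)),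
      leb3.-integrable setT (EFin \o (fun z => g z.1.1 * phi z)) &
  (\int[leb3]_z (H z.1.1 * 'D_(sdir 0) phi z + g z.1.1 * phi z)%:E = 0)%E].
Proof.
move=> pHg C1; have [cphi _ cDphi] := C1; have [cH _ _ lg] := pHg.
have i1 := integrable3_locint (continuous_locint cH) cDphi cK (@Dphi0 _).
have i2 := integrable3_locint lg cphi cK phi0.
split=> //; apply: integral3_slice_x.
  by apply: eq_integrable (integrableD measurableT i1 i2).
move=> t; have := integral_by_parts2_x1 compact_fst_image (slice_support t) pHg
  (slice_C1along t C1).
by under eq_integral do rewrite derive_slice.
Qed.

Lemma integral_by_parts3_x2 h : locint h -> C1along (sdir 1) phi ->
  (\int[leb3]_z (h z.1.1 * 'D_(sdir 1) phi z)%:E = 0)%E.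
Proof.
move=> lh C1; have [cphi _ cDphi] := C1.
apply: integral3_slice_x; first exact: integrable3_locint lh cDphi cK (@Dphi0 _).
move=> t; have := integral_by_parts2_x2 compact_fst_image (slice_support t) lh
  (slice_C1along t C1).
by under eq_integral do rewrite derive_slice.
Qed.

(** The functions c t + h (x_1) are the form of the example, for which c is the
    time derivative. *)
Lemma integral_by_parts3_t h c : locint h -> C1along tdir phi ->
  [/\ leb3.-integrable setT
        (EFin \o (fun z => (c * z.2 + h z.1.1) * 'D_tdir phi z)),
      leb3.-integrable setT (EFin \o (fun z => c * phi z)) &
  (\int[leb3]_z ((c * z.2 + h z.1.1) * 'D_tdir phi z + c * phi z)%:E = 0)%E].
Proof.
move=> lh C1; have [cphi dphi cDphi] := C1.
have l1 : locint (fun=> 1 : R) by apply: continuous_locint => x; exact: cvg_cst.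
have lc : locint (fun=> c) by apply: continuous_locint => x; exact: cvg_cst.
have ctD : continuous (fun z => c * z.2 * 'D_tdir phi z).
  move=> z; apply: cvgM; last exact: cDphi.
  by apply: cvgM; [exact: cvg_cst|exact: cvg_snd].
have i1 := integrable3_locint lh cDphi cK (@Dphi0 _).
have i2 := integrable3_locint lc cphi cK phi0.
have i3 : leb3.-integrable setT
    (EFin \o (fun z : xtspace R => 1 * (c * z.2 * 'D_tdir phi z))).
  apply: (integrable3_locint (h := fun=> 1) l1 ctD cK) => x nK.
  by rewrite Dphi0// mulr0.
have i4 : leb3.-integrable setT
        (EFin \o (fun z => (c * z.2 + h z.1.1) * 'D_tdir phi z)).
  apply: eq_integrable (integrableD measurableT i3 i1) => //.
  by move=> z _; rewrite /= -EFinD mul1r -mulrDl.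
split=> //; apply: integral3_slice_t.
  by apply: eq_integrable (integrableD measurableT i4 i2).
move=> x.
have [M [M0 KM]] := compact_coord_lt3 cK.
have [B1 _ HB1] := compact_support_bounded cK cphi phi0.
have [B2 _ HB2] := compact_support_bounded cK cDphi (@Dphi0 _).
have off t : M <= `|t| -> ~ K (x, t).
  by move=> Mt /KM[] /= _ _; rewrite ltNge Mt.
have cp (f : xtspace R -> R) : continuous f -> continuous (fun t => f (x, t)).
  move=> cf t.
  apply: (continuous_comp (f := fun t : R => (x, t) : xtspace R)); last exact: cf.
  by apply: (@differentiable_continuous R); apply: differentiable_pair.
have pc : singular_primitive (fun t => c * t + h x.1) (fun=> c).
  split=> //.
  - move=> t; apply: cvgD; last exact: cvg_cst.
    by apply: cvgM; [exact: cvg_cst|exact: cvg_id].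
  - move=> t _; have := is_deriveD (is_deriveZ c (is_derive_id t (1 : R)))
      (is_derive_cst (h x.1) t 1).
    by move=> D; apply: (is_derive_eq D); rewrite /GRing.scale /= mulr1 addr0.
  - by move=> t _; exact: cvg_cst.
apply: (integral_by_parts1 (psi := fun t => phi (x, t)) (M := M)
  (B := Num.max B1 B2) pc) => //.
- refine (cp _ cphi).
- refine (cp _ cDphi).
- move=> t; apply: (is_derive_line (l := fun t => (x, t) : xtspace R)) => //.
  move=> s; congr pair; last by rewrite /= /GRing.scale /= mulr1.
  by rewrite /= scaler0 add0r.
- by move=> t; rewrite le_max HB1.
- by move=> t; rewrite le_max HB2 orbT.
- by move=> t /off/phi0.
- by move=> t /off/Dphi0.
Qed.

End Space.

(** * A smooth bump function *)

Section Bump.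
Context {R : realType}.

(** The flat function exp(-1/x) times a power of 1/x.  The negative powers are
    kept because they make the family stable under differentiation. *)
Definition flat n (x : R) : R :=
  if 0 < x then x^-1 ^+ n * expR (- x^-1) else 0.

Lemma flat_le0 n x : x <= 0 -> flat n x = 0.
Proof. by rewrite /flat leNgt => /negbTE ->. Qed.

Lemma flat_ge0 n x : 0 <= flat n x.
Proof.
rewrite /flat; case: ifPn => // x0.
by rewrite mulr_ge0 ?expR_ge0// exprn_ge0// invr_ge0 ltW.
Qed.

Lemma flatS n x : flat n x = x * flat n.+1 x.
Proof.
rewrite /flat; case: ifPn => [x0|]; last by rewrite mulr0.
by rewrite exprS !mulrA divff ?mul1r// gt_eqF.
Qed.

(** With y = 1/x and m = n+1 this is the m-th power of y/m <= e^(y/m). *)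
Lemma flat_bounded n : exists2 C, 0 <= C & forall x, flat n.+1 x <= C.
Proof.
exists (n.+1%:R ^+ n.+1); first by rewrite exprn_ge0.
move=> x; rewrite /flat; case: ifPn => [x0|_]; last by rewrite exprn_ge0.
set y := x^-1; have y0 : 0 < y by rewrite invr_gt0.
rewrite expRN ler_pdivrMr ?expR_gt0//.
have -> : y = y / n.+1%:R * n.+1%:R by rewrite mulfVK// pnatr_eq0.
rewrite mulrC expRM_natl -exprMn_comm; last exact: mulrC.
have a0 : 0 < y / n.+1%:R by rewrite divr_gt0.
set a := y / _ in a0 *; have ea := expR_ge1Dx a.
apply: lerXn2r; rewrite ?nnegrE ?mulr_ge0 ?expR_ge0//; first exact: ltW.
by rewrite ler_wpM2l//; lra.
Qed.

(** At 0 the difference quotient is flat n.+1 h = h flat n.+2 h, and flat n.+2 is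
    bounded. *)
Lemma is_derive_flat n (x : R) :
  is_derive x 1 (flat n) (flat n.+2 x - n%:R * flat n.+1 x).
Proof.
have [x0|x0|->] := ltgtP x 0.
- rewrite !flat_le0 ?ltW// mulr0 subr0.
  have nx : \near x, (fun=> 0) x = flat n x.
    by near=> y; rewrite flat_le0// ltW//; near: y; exact: lt_nbhsl.
  by apply: near_eq_is_derive nx _; exact: is_derive_cst.
- have nx : \near x, (fun y => y^-1 ^+ n * expR (- y^-1)) x = flat n x.
    by near=> y; rewrite /flat ifT//; near: y; exact: lt_nbhsr.
  apply: near_eq_is_derive nx _; rewrite /flat x0.
  have dV : is_derive x 1 (fun y : R => y^-1) (- x ^- 2).
    have xn : x != 0 by rewrite gt_eqF.
    have di : derivable (fun y : R => y) x 1 by exact: derivable_id.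
    apply: DeriveDef; first exact: derivableV.
    rewrite deriveV// (@derive_id R R); by rewrite /GRing.scale /= mulr1.
  have dX := is_deriveX n dV; rewrite exprfctE in dX.
  have dE : is_derive x 1 (fun y : R => expR (- y^-1)) (expR (- x^-1) * x ^- 2).
    have dN := is_deriveN dV; rewrite opprK in dN.
    by apply: (is_derive1_comp _ dN).
  apply: (is_derive_eq (is_deriveM dX dE)).
  rewrite /GRing.scale /=.
  rewrite -!exprVn; case: n {dX} => [|n]; last by rewrite /= !exprS; ring.
  by rewrite /= !expr0 !mul0r mulr0 addr0 subr0 mul1r mulrC.
- rewrite !flat_le0// mulr0 subr0.
  have [C C0 HC] := flat_bounded n.+1.
  suff H : h^-1 *: (flat n (h *: 1 + 0 : R) - flat n (0 : R)) @[h --> 0^'] --> (0 : R).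
    by split; [apply/cvg_ex; exists 0 | apply/cvg_lim].
  apply/cvgrPdist_le => e e0; near=> h.
  rewrite /GRing.scale /= mulr1 addr0 flatS [flat n 0]flat_le0// subr0.
  have h0 : h != 0 by near: h; exact: nbhs_dnbhs_neq.
  rewrite mulKf// sub0r normrN (ger0_norm (flat_ge0 _ _)) flatS.
  apply: le_trans (ler_norm _) _; rewrite normrM (ger0_norm (flat_ge0 _ _)).
  apply: (@le_trans _ _ (`|h| * (C + 1))).
    by rewrite ler_wpM2l// (le_trans (HC _))// lerDl.
  rewrite -ler_pdivlMr; last by lra.
  near: h; apply: dnbhs0_le; rewrite divr_gt0//; lra.
Unshelve. all: end_near. Qed.

End Bump.

Section Smooth.
Context {R : realType} {V : normedModType R}.
Implicit Types (f g : V -> R) (k : nat).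

Lemma CkS k f : Ck k.+1 f -> Ck k f.
Proof.
elim: k f => [|k IH] f; first exact: Ck_continuous.
by move=> [df Df]; split=> // v; apply: IH; exact: Df.
Qed.

Lemma Ck_cst k (c : R) : Ck k (fun _ : V => c).
Proof.
elim: k c => [|k IH] c /=; first by move=> x; exact: cvg_cst.
split=> [y|v]; first exact: differentiable_cst.
rewrite (_ : 'D_v _ = fun=> 0); first exact: IH.
by apply/funext => y; exact: derive_cst.
Qed.

Lemma CkD k f g : Ck k f -> Ck k g -> Ck k (fun y => f y + g y).
Proof.
elim: k f g => [|k IH] f g /=.
  by move=> cf cg x; apply: cvgD; [exact: cf|exact: cg].
move=> [df Df] [dg Dg]; split=> [y|v].
  by apply: differentiableD.
rewrite (_ : 'D_v _ = fun y => 'D_v f y + 'D_v g y).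
  exact: IH.
by apply/funext => y; apply: deriveD; exact: diff_derivable.
Qed.

Lemma CkM k f g : Ck k f -> Ck k g -> Ck k (fun y => f y * g y).
Proof.
elim: k f g => [|k IH] f g.
  by move=> /= cf cg x; apply: cvgM; [exact: cf|exact: cg].
move=> Cf Cg; have [df Df] := Cf; have [dg Dg] := Cg; split=> [y|v].
  by apply: differentiableM.
rewrite (_ : 'D_v _ = fun y => f y * 'D_v g y + g y * 'D_v f y).
  by apply: CkD; apply: IH; [exact: CkS|exact: Dg|exact: CkS|exact: Df].
by apply/funext => y; apply: deriveM; exact: diff_derivable.
Qed.

(** A linear form has constant directional derivatives. *)
Lemma Ck_linear_form k f (c : V -> R) : (forall y, differentiable f y) ->
  (forall h v y, f (h *: v + y) = h * c v + f y) -> Ck k f.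
Proof.
move=> df fE; case: k => [y|k]; first exact: differentiable_continuous.
split=> // v; rewrite (_ : 'D_v f = fun=> c v); first exact: Ck_cst.
apply/funext => y; apply/cvg_lim => //.
apply: (@cvg_trans _ ((fun=> c v) h @[h --> 0^'])); last exact: cvg_cst.
apply: near_eq_cvg; near=> h; have h0 : h != 0 by near: h; exact: nbhs_dnbhs_neq.
by rewrite /= fE addrK /GRing.scale /= mulKf.
Unshelve. all: end_near. Qed.

(** The chain rule gives flat n.+2 and flat n.+1 composed with f as factors, so the
    induction on k needs the statement for all n at once. *)
Lemma Ck_flat k n f : (forall j, Ck j f) -> Ck k (fun y => flat n (f y)).
Proof.
move=> Cf; have df : forall y, differentiable f y by case: (Cf 1).
have dflat m (x : R) : differentiable (flat m) x.
  by apply/derivable1_diffP; case: (is_derive_flat m x).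
have dff m y : differentiable (flat m \o f) y.
  by apply: differentiable_comp.
elim: k n => [|k IH] n; first by move=> y; apply: (differentiable_continuous (dff n y)).
split=> [y|v]; first exact: dff.
rewrite (_ : 'D_v _ = fun y =>
    (flat n.+2 (f y) + - n%:R * flat n.+1 (f y)) * 'D_v f y).
  apply: CkM; last by case: (Cf k.+1) => _ /(_ v).
  by apply: CkD => //; apply: CkM => //; exact: Ck_cst.
apply/funext => y; rewrite deriveE; last exact: dff.
rewrite diff_comp//= diff1E// -deriveE// derive1E.
by have [_ ->] := is_derive_flat n (f y); rewrite /GRing.scale /= mulrC mulNr.
Qed.

End Smooth.

Lemma differentiable_fst (R : realType) (V W : normedModType R) (z : V * W) :
  differentiable fst z.
Proof.
by apply: (@linear_differentiable R (V * W)%type V fst z) => ?; exact: cvg_fst.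
Qed.

Lemma differentiable_snd (R : realType) (V W : normedModType R) (z : V * W) :
  differentiable snd z.
Proof.
by apply: (@linear_differentiable R (V * W)%type W snd z) => ?; exact: cvg_snd.
Qed.

Section SpaceTimeBump.
Context {R : realType}.
Implicit Types (z : xtspace R) (e : R).

(** A bump of width e in x_1 only.  It is even and decreasing in |x_1|, so that its
    x_1-derivative and any signed power of x_1 have a product of constant sign. *)
Definition st_bump e z : R :=
  flat 0 (1 + (-1) * (e^-1 * z.1.1 * (e^-1 * z.1.1))) *
  (flat 0 (1 + (-1) * (z.1.2 * z.1.2)) *
   flat 0 (1 + (-1) * ((z.2 + - 2) * (z.2 + - 2)))).

Definition st_box e : set (xtspace R) :=
  `[- e, e] `*` `[- 1, 1] `*` `[1, 3].

Let Ck_x1 k : Ck k (fun z : xtspace R => z.1.1).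
Proof.
apply: (@Ck_linear_form _ _ _ _ (fun z : xtspace R => z.1.1)) => // z.
apply: (differentiable_comp (f := fst) (g := fst)).
  exact: differentiable_fst.
exact: differentiable_fst.
Qed.

Let Ck_x2 k : Ck k (fun z : xtspace R => z.1.2).
Proof.
apply: (@Ck_linear_form _ _ _ _ (fun z : xtspace R => z.1.2)) => // z.
apply: (differentiable_comp (f := fst) (g := snd)).
  exact: differentiable_fst.
exact: differentiable_snd.
Qed.

Let Ck_t k : Ck k (fun z : xtspace R => z.2).
Proof.
apply: (@Ck_linear_form _ _ _ _ (fun z : xtspace R => z.2)) => // z.
exact: differentiable_snd.
Qed.

Lemma Ck_st_bump k e : Ck k (st_bump e).
Proof.
have C m c (f : xtspace R -> R) : (forall j, Ck j f) ->
    Ck m (fun z => 1 + (-1) * (c * f z * (c * f z))).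
  move=> Cf; do ![apply: CkD|apply: CkM] => //; exact: Ck_cst.
apply: CkM; [|apply: CkM]; apply: Ck_flat => j.
- exact: C.
- do ![apply: CkD|apply: CkM] => //; exact: Ck_cst.
- do ![apply: CkD|apply: CkM] => //; exact: Ck_cst.
Qed.

Lemma st_bump_ge0 e z : 0 <= st_bump e z.
Proof. by rewrite /st_bump !mulr_ge0 ?flat_ge0. Qed.

Lemma flat0_le1 (x : R) : flat 0 x <= 1.
Proof.
rewrite /flat; case: ifPn => // x0; rewrite expr0 mul1r expR_le1.
by rewrite oppr_le0 invr_ge0 ltW.
Qed.

Lemma st_bump_le1 e z : st_bump e z <= 1.
Proof.
by rewrite /st_bump mulr_ile1 ?mulr_ge0 ?mulr_ile1 ?flat_ge0 ?flat0_le1.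
Qed.

(** Outside the box one of the three factors is flat 0 at a nonpositive point. *)
Lemma st_bump0 e z : 0 < e -> ~ st_box e z -> st_bump e z = 0.
Proof.
move=> e0; have key (x : R) : 1 < `|x| -> 1 + -1 * (x * x) <= 0.
  move=> x1; have : 1 < x ^+ 2 by rewrite -real_normK ?num_real// exprn_egt1.
  by rewrite expr2; lra.
have [z1|z1] := ltP 1 `|e^-1 * z.1.1|.
  by rewrite /st_bump flat_le0 ?mul0r//; exact: key.
have [z2|z2] := ltP 1 `|z.1.2|.
  rewrite /st_bump [flat 0 (1 + -1 * (z.1.2 * _))]flat_le0 ?(mul0r,mulr0)//.
  exact: key.
have [z3|z3] := ltP 1 `|z.2 + - 2|.
  by rewrite /st_bump [flat 0 (1 + -1 * ((z.2 + _) * _))]flat_le0 ?mulr0//; exact: key.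
case; split; first split; rewrite /= in_itv/=.
- move: z1; rewrite normrM normfV (gtr0_norm e0) mulrC ler_pdivrMr// mul1r.
  by rewrite ler_norml.
- by rewrite -ler_norml.
- by move: z3; rewrite ler_norml; lra.
Qed.

Lemma compact_st_box e : compact (st_box e).
Proof. by apply: compact_setX; [apply: compact_setX|]; exact: segment_compact. Qed.

Lemma st_box_sub e : st_box e `<=` Omega_T [set: xspace R] +oo%E.
Proof.
move=> z [_ /=]; rewrite in_itv/= => /andP[z1 _]; split=> //=; split.
  exact: lt_le_trans z1.
exact: ltry.
Qed.

Lemma test_function_st_bump e : 0 < e ->
  test_function (Omega_T [set: xspace R] +oo%E) (st_bump e).
Proof.
move=> e0; split=> [k|]; first exact: Ck_st_bump.
exists (st_box e); split; [exact: compact_st_box|exact: st_box_sub|].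
by move=> z; exact: st_bump0.
Qed.

(** Minus the x_1-derivative of the bump, as a function of real variables. *)
Definition bump_slope e (x y t : R) : R :=
  2 * x * e^-1 ^+ 2 * flat 2 (1 + (-1) * (e^-1 * x * (e^-1 * x))) *
  (flat 0 (1 + (-1) * (y * y)) * flat 0 (1 + (-1) * ((t + - 2) * (t + - 2)))).

Lemma derive_st_bump e z :
  'D_(sdir 0) (st_bump e) z = - bump_slope e z.1.1 z.1.2 z.2.
Proof.
case: z => -[x y] t /=; rewrite /bump_slope.
set c := (X in _ * X).
have d1 : is_derive x 1 (st_bump e \o (fun x => ((x, y), t) : xtspace R))
    ('D_(sdir 0) (st_bump e) ((x, y), t)).
  apply: is_derive_line.
    move=> h; congr (_, _); last by rewrite /= scaler0 add0r.
    by congr (_, _); rewrite /= /GRing.scale /= ?mulr0 ?add0r ?mulr1.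
  by apply: diff_derivable; case: (Ck_st_bump 1 e).
have dq : is_derive x 1 (fun x : R => 1 + -1 * (e^-1 * x * (e^-1 * x)))
    (- (2 * x * e^-1 ^+ 2)).
  have di : is_derive x 1 (fun x : R => e^-1 * x) (e^-1).
    apply: (is_derive_eq (is_deriveZ e^-1 (is_derive_id x (1 : R)))).
    by rewrite /GRing.scale /= mulr1.
  have dm := is_deriveZ (-1) (is_deriveM di di).
  apply: (is_derive_eq (is_deriveD (is_derive_cst (1 : R) x 1) dm)).
  by rewrite /GRing.scale /=; ring.
have d0 := @is_derive1_comp R (flat 0)
  (fun x : R => 1 + -1 * (e^-1 * x * (e^-1 * x))) x _ _ (is_derive_flat 0 _) dq.
have d2 : is_derive x 1 (st_bump e \o (fun x => ((x, y), t) : xtspace R))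
  (c * ((flat 2 (1 + -1 * (e^-1 * x * (e^-1 * x))) - 0%:R *
     flat 1 (1 + -1 * (e^-1 * x * (e^-1 * x)))) * (- (2 * x * e^-1 ^+ 2)))).
  rewrite (_ : st_bump e \o _ = c \*: (flat 0 \o
      (fun x : R => 1 + -1 * (e^-1 * x * (e^-1 * x))))).
    by apply: (is_derive_eq (is_deriveZ c d0)).
  by apply/funext => s; rewrite /st_bump /= /GRing.scale /= mulrC.
have [_ <-] := d1; have [_ ->] := d2; ring.
Qed.

End SpaceTimeBump.

(** * Integrals over boxes that shrink to the line x_1 = 0 *)

Section Sharpness.
Context {R : realType}.
Local Notation mu := (@lebesgue_measure R).
Local Notation DT := (Omega_T [set: xspace R] +oo%E).

Lemma leb3_box (a1 b1 a2 b2 a3 b3 : R) : a1 <= b1 -> a2 <= b2 -> a3 <= b3 ->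
  leb3 (`[a1, b1] `*` `[a2, b2] `*` `[a3, b3]) =
  ((b1 - a1) * (b2 - a2) * (b3 - a3))%:E.
Proof.
move=> h1 h2 h3; have mE (a b : R) : a <= b -> mu `[a, b] = (b - a)%:E.
  move=> ab; rewrite lebesgue_measure_itv /= lte_fin.
  by case: ifPn => [//|]; rewrite -leNgt => ba; rewrite (@le_anti _ _ a b) ?subrr ?ab.
have E2 : leb2s (`[a1, b1] `*` `[a2, b2]) = ((b1 - a1) * (b2 - a2))%:E.
  transitivity (mu `[a1, b1] * mu `[a2, b2])%E; last by rewrite !mE.
  exact: product_measure1E.
transitivity (leb2s (`[a1, b1] `*` `[a2, b2]) * mu `[a3, b3])%E.
  by apply: product_measure1E => //; exact: measurableX.
by rewrite E2 mE.
Qed.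

Lemma measurable_st_box (e : R) : measurable (st_box e).
Proof. by apply: measurableX => //; exact: measurableX. Qed.

Lemma measurable_DT : measurable DT.
Proof.
apply: measurableX => //.
rewrite (_ : time_interval _ = `]0, +oo[%classic)//.
apply/seteqP; split=> t /=; rewrite in_itv/= andbT; first by case.
by move=> t0; split=> //; exact: ltry.
Qed.

Lemma st_box_le (e : R) : e <= 1 -> st_box e `<=` st_box 1.
Proof.
by move=> e1 z [[/=]]; rewrite !in_itv/= => ? ? ?; split; [split|];
  rewrite /= in_itv/=//; lra.
Qed.

(** Absolute continuity of the integral: the boxes have measure 8 e. *)
Lemma integral_st_box_lt (f : xtspace R -> R) (eta : R) :
  measurable_fun DT f -> (forall z, 0 <= f z) -> 0 < eta ->
  (\int[leb3]_(z in st_box 1) (f z)%:E < +oo)%E ->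
  exists e, [/\ 0 < e, e <= 1 &
    (\int[leb3]_(z in st_box e) (f z)%:E < eta%:E)%E].
Proof.
move=> mf f0 eta0 foo.
have mf1 : measurable_fun (st_box 1) f.
  by apply: measurable_funS mf; [exact: measurable_DT|exact: st_box_sub].
have i1 : leb3.-integrable (st_box 1) (EFin \o f).
  apply/integrableP; split; first exact/measurable_EFinP.
  by under eq_integral do rewrite /= ger0_norm//.
have i2 : leb3.-integrable setT (EFin \o (f \_ (st_box 1))).
  rewrite -restrict_EFin; apply/(integrable_mkcond _ _).1 => //.
  exact: measurable_st_box.
have [d [d0 Hd]] := integral_normr_continuous i2 eta0.
exists (Num.min 1 (d / 16)).
have e0 : 0 < Num.min 1 (d / 16) by rewrite lt_min ltr01 divr_gt0.
have e1 : Num.min 1 (d / 16) <= 1 by rewrite ge_min lexx.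
have ed : Num.min 1 (d / 16) <= d / 16 by rewrite ge_min lexx orbT.
set e := Num.min _ _ in e0 e1 ed *; split=> //.
have ms := measurable_st_box e.
have := Hd (st_box e) ms; rewrite [leb3 _]leb3_box; [|lra..].
have -> : (((e - - e) * (1 - -1) * (3 - 1))%:E < d%:E)%E by rewrite lte_fin; lra.
move=> /(_ isT); rewrite -lte_fin /Rintegral fineK.
  rewrite (eq_integral (fun z => (f z)%:E))// => z; rewrite inE => ez.
  by rewrite patchE mem_set ?ger0_norm//; exact: st_box_le ez.
apply: integrable_fin_num => //.
apply: (@integrableS _ _ _ leb3 setT) => //.
exact: (integrable_norm i2).
Qed.

Lemma flat_lb n (x : R) : 4^-1 <= x -> x <= 1 -> expR (- 4) <= flat n x.
Proof.
move=> x1 x2; have x0 : 0 < x by lra.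
rewrite /flat x0 -[leLHS]mul1r ler_pM ?expR_ge0//.
  by rewrite exprn_ege1// invf_ge1.
by rewrite ler_expR lerN2 invf_ple ?posrE// invrK.
Qed.

Lemma integral_box_lb (f : xtspace R -> R) (O : set (xtspace R)) (c : R)
    (a1 b1 a2 b2 a3 b3 : R) :
  a1 <= b1 -> a2 <= b2 -> a3 <= b3 ->
  measurable O -> measurable_fun O f -> (forall z, O z -> 0 <= f z) ->
  `[a1, b1] `*` `[a2, b2] `*` `[a3, b3] `<=` O -> 0 <= c ->
  (forall z, `[a1, b1]%classic z.1.1 -> `[a2, b2]%classic z.1.2 ->
    `[a3, b3]%classic z.2 -> c <= f z) ->
  ((c * ((b1 - a1) * (b2 - a2) * (b3 - a3)))%:E <=
    \int[leb3]_(z in O) (f z)%:E)%E.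
Proof.
move=> h1 h2 h3 mO mf f0 BO c0 cf.
have mB : measurable (`[a1, b1] `*` `[a2, b2] `*` `[a3, b3] : set (xtspace R)).
  by apply: measurableX => //; exact: measurableX.
rewrite EFinM -leb3_box// -integral_cst//.
apply: (@le_trans _ _ (\int[leb3]_(z in `[a1, b1] `*` `[a2, b2] `*` `[a3, b3])
  (f z)%:E)%E).
  apply: ge0_le_integral => //.
  - by apply/measurable_EFinP; apply: measurable_funS mf.
  - by move=> z [[z1 z2] z3]; rewrite lee_fin; exact: cf.
apply: ge0_subset_integral => //; exact/measurable_EFinP.
Qed.

Lemma powR_lb (e q x : R) : 0 < x -> x <= e -> e <= 1 -> q <= -1 ->
  e^-1 <= x `^ q.
Proof.
move=> x0 xe e1 q1; have x1 : 0 < x <= 1 by rewrite x0 (le_trans xe).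
apply: le_trans (ger_powR x1 q1).
rewrite powR_inv1; last exact: ltW.
by rewrite lef_pV2 ?posrE// (lt_le_trans x0).
Qed.

(** Where d/2 <= x_1 <= d the square is at least C^2 / d, and this part of the box
    of width d has measure 2 d, so that the integral over the box never falls below
    2 C^2, whatever d is. *)
Lemma not_L2_power (C e : R) : C != 0 -> e <= - 2^-1 ->
  ~ Lp_loc 2 DT (fun z => C * `|z.1.1| `^ e).
Proof.
move=> C0 e2 [mN /(_ (st_box 1) (@compact_st_box _ _) (@st_box_sub _ _))].
set f := fun z : xtspace R => `|C * `|z.1.1| `^ e| `^ 2 => foo.
have C2 : 0 < C ^+ 2 by rewrite exprn_even_gt0.
have mf : measurable_fun DT f.
  rewrite (_ : f = (fun z => (C * `|z.1.1| `^ e) ^+ 2)).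
    by apply: measurable_funX.
  by apply/funext => z; rewrite /f powR_mulrn// real_normK// num_real.
have [|d [d0 d1 Hd]] := integral_st_box_lt mf _ C2 foo.
  by move=> z; exact: powR_ge0.
have msub : st_box d `<=` DT by exact: st_box_sub.
have : ((C ^+ 2 * d^-1 * ((d - d / 2) * (1 - -1) * (3 - 1)))%:E <=
    \int[leb3]_(z in st_box d) (f z)%:E)%E.
  apply: integral_box_lb; rewrite ?ler_pdivrMr//; try lra.
  - exact: measurable_st_box.
  - by apply: measurable_funS mf; [exact: measurable_DT|].
  - by move=> z _; exact: powR_ge0.
  - move=> z [[/= z1 z2] z3]; split=> //; split=> //=; move: z1.
    by rewrite !in_itv/=; lra.
  - by rewrite mulr_ge0 ?ltW// invr_gt0.
  - move=> z /=; rewrite !in_itv/= => /andP[z1 z2] _ _.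
    have z0 : 0 < z.1.1 by lra.
    rewrite /f powR_mulrn// normrM exprMn real_normK ?num_real//.
    rewrite ler_pM2l// (ger0_norm (powR_ge0 _ _)) (gtr0_norm z0).
    rewrite -powR_mulrn ?powR_ge0// -powRrM; apply: powR_lb => //; lra.
move=> /le_lt_trans/(_ Hd); rewrite lte_fin.
rewrite (_ : C ^+ 2 * d^-1 * _ = 2 * C ^+ 2); last by field; rewrite gt_eqF.
by lra.
Qed.

Lemma Lp_loc_bound (q : R) (k : R -> R) (f : xtspace R -> R) O :
  measurable_fun setT f -> locint k ->
  (forall z, `|f z| `^ q <= k z.1.1) -> Lp_loc q O f.
Proof.
move=> mf lk fk; split; first exact: measurable_funTS.
move=> K cK KO; have [M [M0 KM]] := compact_coord_lt3 cK.
have mK := compact_measurable3 cK.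
pose g := (fun z => `|f z| `^ q) \_ (box3 M).
have mfq : measurable_fun setT (fun z => `|f z| `^ q).
  exact: (measurableT_comp (measurable_normr_powR q)).
have mg : measurable_fun setT g.
  by apply/(measurable_restrictT _ (measurable_box3 M)); exact: measurable_funTS.
have ig : leb3.-integrable setT (EFin \o g).
  apply: (integrable3_le mg (proj2 lk M)) => z bz.
    rewrite /g patchE mem_set// ger0_norm ?powR_ge0//.
  by rewrite /g patchE memNset.
have KB : K `<=` box3 M.
  by move=> z /KM[z1 z2 z3]; split; [split|];
    rewrite /= in_itv/= -ler_norml ltW.
move: ig => /integrableP[_]; apply: le_lt_trans.
rewrite (eq_integral (fun z => `|(g z)%:E|%E)); last first.
  move=> z; rewrite inE => Kz; rewrite /= /g patchE mem_set; last exact: KB.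
  by rewrite (ger0_norm (powR_ge0 _ _)).
apply: ge0_subset_integral => //.
by apply: measurableT_comp => //; exact/measurable_EFinP.
Qed.

End Sharpness.

(** * Signed powers without a square integrable weak derivative *)

Section NoWeakDerivative.
Context {R : realType}.
Local Notation mu := (@lebesgue_measure R).
Local Notation DT := (Omega_T [set: xspace R] +oo%E).

(** For b <= 1/2 and 0 < x <= 1 the signed power dominates the square root of x. *)
Lemma spow_lb (b x e : R) : b <= 2^-1 -> 0 < e -> e / 2 <= x -> x <= 1 ->
  Num.sqrt e / 2 <= spow b x.
Proof.
move=> b2 e0 ex x1; have x0 : 0 < x by lra.
have -> : spow b x = x `^ b.
  have := normr_spow b (lt0r_neq0 x0); rewrite (gtr0_norm x0) ger0_norm//.
  by rewrite /spow mulr_ge0 ?powR_ge0 ?ltW.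
apply: (@le_trans _ _ (x `^ 2^-1)); last first.
  by apply: ger_powR b2; rewrite x0.
rewrite powR12_sqrt ?(ltW x0)//.
have s0 : 0 <= Num.sqrt e / 2 by rewrite divr_ge0 ?sqrtr_ge0.
rewrite -[leLHS](ger0_norm s0) -sqrtr_sqr; apply: ler_wsqrtr.
rewrite expr_div_n sqr_sqrtr ?(ltW e0)//.
by rewrite (_ : 2 ^+ 2 = 4); [lra|ring].
Qed.

(** Both factors have the sign of x. *)
Lemma bump_slope_spow_ge0 (k b e x y t : R) : 0 <= k ->
  0 <= k * spow b x * bump_slope e x y t.
Proof.
move=> k0; rewrite /bump_slope /spow; set F2 := flat 2 _; set F0 := _ * flat 0 _.
have F0p : 0 <= F0 by rewrite mulr_ge0 ?flat_ge0.
have F2p : 0 <= F2 by exact: flat_ge0.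
rewrite (_ : _ * _ = 2 * k * (x ^+ 2 * `|x| `^ (b - 1)) * e^-1 ^+ 2 * F2 * F0);
  last by ring.
have := sqr_ge0 x; have := sqr_ge0 e^-1; have := powR_ge0 `|x| (b - 1).
set X := x ^+ 2; set Y := _ ^+ 2; set Z := _ `^ _ => ? ? ?.
clearbody X Y Z F0 F2; by rewrite !mulr_ge0.
Qed.

Lemma bump_slope_lb (e x y t : R) : 0 < e -> e / 2 <= x <= 3 / 4 * e ->
  0 <= y <= 2^-1 -> 2 <= t <= 5 / 2 ->
  e^-1 * expR (- 4) ^+ 3 <= bump_slope e x y t.
Proof.
move=> e0 xe y1 t1; rewrite /bump_slope; pose E := @expR R (- 4).
have E0 : 0 <= E by exact: expR_ge0.
have x1 : 2^-1 <= e^-1 * x <= 3 / 4.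
  by rewrite ler_pdivlMl// ler_pdivrMl//; lra.
have -> : 2 * x * e^-1 ^+ 2 = e^-1 * (2 * (e^-1 * x)) by ring.
set X := e^-1 * x in x1 *.
have F2 : E <= flat 2 (1 + -1 * (X * X)) by apply: flat_lb; nra.
have F02 : E <= flat 0 (1 + -1 * (y * y)) by apply: flat_lb; nra.
have F03 : E <= flat 0 (1 + -1 * ((t + -2) * (t + -2))) by apply: flat_lb; nra.
clearbody X; rewrite -!mulrA ler_pM2l ?invr_gt0// -[leLHS]mul1r.
rewrite [2 * _]mulrA; apply: ler_pM; [by []|by rewrite exprn_ge0|lra|].
rewrite exprS; apply: ler_pM => //; rewrite ?sqr_ge0//.
by rewrite expr2; apply: ler_pM.
Qed.

(** Suppose that w is a square integrable weak derivative, and test it with the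
    bump of width e.  On the left, the integrand has constant sign and modulus of
    order e^(1/2) / e on a box of measure of order e, which gives at least
    c1 e^(1/2).  On the right, the inequality of Cauchy and Schwarz gives at most
    a constant times e^(1/2) I^(1/2), where I is the integral of w^2 over the
    support of the bump.  Since I tends to 0 with e, this is a contradiction.
    The argument covers the blow-up (b < 0), the jump (b = 0) and the borderline
    case b = 1/2 at once. *)
Lemma no_L2_weak_derivative (k b : R) (w : xtspace R -> R) :
  0 < k -> b <= 2^-1 -> measurable_fun DT w ->
  (\int[leb3]_(z in st_box 1) (w z ^+ 2)%:E < +oo)%E ->
  ~ (forall phi, test_function DT phi ->
    \int[leb3]_(z in DT) (k * spow b z.1.1 * 'D_(sdir 0) phi z)%:E =
    - \int[leb3]_(z in DT) (w z * phi z)%:E)%E.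
Proof.
move=> k0 b2 mw w2 H.
have mDT := @measurable_DT R.
pose E := @expR R (- 4).
have E0 : 0 < E by exact: expR_gt0.
(* the integrand on the left is at least k (sqrt e / 2) (E^3 / e) on a box of
   measure e / 16 *)
pose c1 := k * E ^+ 3 / 32.
have c10 : 0 < c1 by rewrite divr_gt0// mulr_gt0// exprn_gt0.
have mw2 : measurable_fun DT (fun z => w z ^+ 2) by exact: measurable_funX.
(* if I < c1^2 / 8, then the term 4 I / c1 of the upper bound is less than c1 / 2 *)
have eta0 : 0 < c1 ^+ 2 / 8 by rewrite divr_gt0// exprn_gt0.
have [e [e0 e1 He]] := integral_st_box_lt mw2 (fun z => sqr_ge0 _) eta0 w2.
pose phi := st_bump e.
have tphi : test_function DT phi by exact: test_function_st_bump.
have [cphi dphi cDphi] := test_function_C1along (sdir 0) tphi.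
pose P z := - (k * spow b z.1.1 * 'D_(sdir 0) phi z).
have P0 z : 0 <= P z.
  by rewrite /P derive_st_bump mulrN opprK bump_slope_spow_ge0 ?ltW.
have mP : measurable_fun DT P.
  apply: measurable_funTS; apply: measurableT_comp => //.
  apply: measurable_funM; last exact: continuous_measurable3.
  apply: measurable_funM => //; apply: (measurableT_comp (measurable_spow b)).
  by apply: (measurableT_comp measurable_fst); exact: measurable_fst.
have intP : (\int[leb3]_(z in DT) (P z)%:E = \int[leb3]_(z in DT) (w z * phi z)%:E)%E.
  apply: oppe_inj; rewrite -(H _ tphi) -integral_ge0N;
    last by move=> z _; rewrite lee_fin.
  by apply: eq_integral => z _; rewrite -EFinN /P opprK.
pose s := Num.sqrt e; have s0 : 0 < s by rewrite sqrtr_gt0.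
have es : s ^+ 2 = e by rewrite sqr_sqrtr// ltW.
have lower : ((c1 * s)%:E <= \int[leb3]_(z in DT) (P z)%:E)%E.
  have -> : c1 * s = (k * (s / 2) * (e^-1 * E ^+ 3)) *
     ((3 / 4 * e - e / 2) * (2^-1 - 0) * (5 / 2 - 2)).
    by rewrite /c1; field; rewrite gt_eqF.
  apply: integral_box_lb => //; try lra.
  - move=> z [[/= _ _]]; rewrite in_itv/= => z3; split=> //; split => //=; first lra.
    exact: ltry.
  - by rewrite !mulr_ge0 ?exprn_ge0 ?invr_ge0// ltW.
  - move=> z /=; rewrite !in_itv/= => z1 z2 z3.
    rewrite /P derive_st_bump mulrN opprK.
    have sp : s / 2 <= spow b z.1.1 by apply: spow_lb => //; lra.
    apply: ler_pM.
    + by rewrite mulr_ge0 ?divr_ge0// ltW.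
    + by rewrite mulr_ge0 ?invr_ge0 ?exprn_ge0// ltW.
    + by rewrite ler_pM2l.
    + exact: bump_slope_lb.
(* Young's inequality with weight s L bounds |w| by (s L / 2) w^2 + 1 / (2 s L);
   for this L the constant term contributes exactly half of the lower bound *)
pose L := 8 / c1; have L0 : 0 < L by rewrite divr_gt0.
have sL0 : 0 < s * L by rewrite mulr_gt0.
have upper : (\int[leb3]_(z in DT) (w z * phi z)%:E <=
    \int[leb3]_(z in st_box e) ((s * L / 2) * (w z ^+ 2) + (2 * (s * L))^-1)%:E)%E.
  have mwphi : measurable_fun DT (fun z => w z * phi z).
    apply: measurable_funM => //; apply: measurable_funTS.
    exact: continuous_measurable3.
  have ms := measurable_st_box e.
  have sDT : st_box e `<=` DT by exact: st_box_sub.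
  apply: le_trans (lee_abs _) _; apply: le_trans (le_abse_integral _ _ _) _ => //.
    exact/measurable_EFinP.
  rewrite (integral_mkcond DT) (eq_integral
    ((fun z => `|(w z * phi z)%:E|%E) \_ (st_box e))); last first.
    move=> z _; rewrite !patchE; case: ifPn => zD; case: ifPn => zs //.
      by rewrite /phi st_bump0 ?mulr0 ?abse0//; move: zs; rewrite notin_setE.
    by move: zD; rewrite mem_set//; apply: sDT; rewrite inE in zs.
  rewrite -integral_mkcond; apply: ge0_le_integral => //.
  - apply: measurableT_comp => //; apply/measurable_EFinP.
    exact: measurable_funS mwphi.
  - apply/measurable_EFinP; apply: measurable_funD => //; apply: measurable_funM => //.
    exact: measurable_funS mw2.
  - move=> z _; rewrite /= lee_fin normrM (ger0_norm (st_bump_ge0 _ _)).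
    have p1 := st_bump_le1 e z.
    apply: (@le_trans _ _ `|w z|); first by rewrite ler_piMr.
    rewrite -[w z ^+ 2]real_normK ?num_real//; set a := `|w z|.
    have := sqr_ge0 (s * L * a - 1) => h.
    rewrite -(ler_pM2l (x := 2 * (s * L))); last by rewrite mulr_gt0.
    rewrite mulrDr divff; last by rewrite gt_eqF// mulr_gt0.
    by nra.
have ms := measurable_st_box e.
have mw2e : measurable_fun (st_box e) (fun z => w z ^+ 2).
  by apply: measurable_funS mw2 => //; exact: st_box_sub.
move: upper; rewrite -intP => /(le_trans lower).
under eq_integral do rewrite EFinD.
rewrite ge0_integralD//; last 3 first.
- by move=> z _; rewrite lee_fin mulr_ge0 ?sqr_ge0 ?divr_ge0 ?ltW.
- by apply/measurable_EFinP; apply: measurable_funM.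
- by move=> z _; rewrite lee_fin invr_ge0 mulr_ge0// ltW.
under eq_integral do rewrite EFinM.
rewrite ge0_integralZl//; last 3 first.
- exact/measurable_EFinP.
- by move=> z _; rewrite lee_fin sqr_ge0.
- by rewrite lee_fin divr_ge0// ltW.
rewrite integral_cst// leb3_box; [|lra..].
have I0 : (0 <= \int[leb3]_(z in st_box e) (w z ^+ 2)%:E)%E.
  by apply: integral_ge0 => z _; rewrite lee_fin sqr_ge0.
move: He I0; case: (\int[leb3]_(z in st_box e) (w z ^+ 2)%:E)%E => [I| |] //.
rewrite lte_fin lee_fin => He I0; rewrite -!EFinM -EFinD lee_fin.
have -> : (2 * (s * L))^-1 * ((e - - e) * (1 - -1) * (3 - 1)) = s * (c1 / 2).
  rewrite -es /L; field; rewrite !gt_eqF//.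
have -> : s * L / 2 * I = s * (4 * I / c1) by rewrite /L; field; rewrite gt_eqF.
rewrite -mulrDr mulrC ler_pM2l// leNgt => /negP; apply.
suff : 4 * I / c1 < c1 / 2 by lra.
by rewrite ltr_pdivrMr//; lra.
Qed.

End NoWeakDerivative.

(** * The example *)

Section Example.
Context {R : realType}.
Local Notation mu := (@lebesgue_measure R).
Local Notation DT := (Omega_T [set: xspace R] +oo%E).

Lemma I2_cases (i : 'I_2) : i = 0 \/ i = 1.
Proof.
by case: i => -[|[|//]] ?; [left|right]; apply/val_inj.
Qed.

Lemma derive_sdir0 (f : xtspace R -> R) z d :
  is_derive (z.1.1 : R) 1 (fun x : R => f ((x, z.1.2), z.2)) d ->
  'D_(sdir 0) f z = d.
Proof.
case: z => -[x y] t /=; apply: (derive_line (l := fun x => ((x, y), t) : xtspace R)).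
move=> h; congr (_, _); last by rewrite /= scaler0 add0r.
by congr (_, _); rewrite /= /GRing.scale /= ?mulr0 ?add0r ?mulr1.
Qed.

Lemma derive_sdir1_eq0 (f : xtspace R -> R) z :
  (forall x y y' t, f ((x, y), t) = f ((x, y'), t)) ->
  'D_(sdir 1) f z = 0.
Proof.
move=> fE; case: z => -[x y] t /=.
apply: (derive_line (l := fun y => ((x, y), t) : xtspace R)).
  move=> h; congr (_, _); last by rewrite /= scaler0 add0r.
  by congr (_, _); rewrite /= /GRing.scale /= ?mulr0 ?add0r ?mulr1.
have -> : f \o (fun y => ((x, y), t) : xtspace R) = fun=> f ((x, y), t).
  by apply/funext => y' /=; exact: fE.
exact: is_derive_cst.
Qed.

Lemma locint_normr_powR (q : R) : -1 < q -> locint (fun y : R => `|y| `^ q).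
Proof.
move=> q1; split; first exact: measurable_normr_powR.
by move=> M; exact: integrable_normr_powR.
Qed.

Lemma locintZ (r : R) h : locint h -> locint (fun y : R => r * h y).
Proof.
move=> [mh ih]; split; first exact: measurable_funM.
by move=> M; apply: eq_integrable (integrableZl _ r (ih M)).
Qed.

Lemma continuous_x1 (h : R -> R) : continuous h ->
  continuous (fun z : xtspace R => h z.1.1).
Proof.
move=> ch z.
apply: (continuous_comp (f := fun z : xtspace R => z.1.1 : R)); last exact: ch.
apply: (@differentiable_continuous R).
by apply: (differentiable_comp (f := fst) (g := fst)); exact: differentiable_fst.
Qed.

Lemma continuous_powR_norm (q : R) (T : topologicalType) (f : T -> R) :
  0 < q -> continuous f -> continuous (fun x => `|f x| `^ q).
Proof.
move=> q0 cf x; apply: (continuous_comp (g := fun y : R => `|y| `^ q)).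
  exact: cf.
exact: continuous_normr_powR.
Qed.

(** Turns the vanishing of the integral of f + h over the whole space into the
    form in which weak derivatives on O are defined. *)
Lemma integral_opp_of_sum d (T : measurableType d)
    (m : {measure set T -> \bar R}) (O : set T) (f h : T -> R) :
  m.-integrable setT (EFin \o f) -> m.-integrable setT (EFin \o h) ->
  (forall x, ~ O x -> f x = 0) -> (forall x, ~ O x -> h x = 0) ->
  (\int[m]_x (f x + h x)%:E = 0)%E ->
  (\int[m]_(x in O) (f x)%:E = - \int[m]_(x in O) (h x)%:E)%E.
Proof.
move=> fi hi f0 h0; rewrite (integral_vanish m f0) (integral_vanish m h0).
under eq_integral do rewrite EFinD.
rewrite integralD//.
have := integrable_fin_num measurableT fi; have := integrable_fin_num measurableT hi.
rewrite /comp; case: (\int[m]_x (f x)%:E)%E => [x| |] //.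
case: (\int[m]_x (h x)%:E)%E => [y| |] // _ _ [] xy.
by rewrite -EFinN; congr (_%:E); apply/eqP; rewrite -addr_eq0 xy.
Qed.

Lemma integral_DT_iter (f : xtspace R -> R) :
  leb3.-integrable setT (EFin \o f) -> (forall z, ~ DT z -> f z = 0) ->
  (\int[leb1]_(t in time_interval +oo%E) \int[leb2]_(x in [set: xspace R])
     (f (x, t))%:E = \int[leb3]_(z in DT) (f z)%:E)%E.
Proof.
move=> fi f0; rewrite [RHS]integral_vanish// -integral3_iter//.
rewrite integral_mkcond; apply: eq_integral => t _; rewrite patchE.
case: ifPn => //; rewrite notin_setE => nt; apply/esym.
by apply: integral0_eq => x _; rewrite f0// => -[].
Qed.

(** The gradient of the example is always parallel to the x_1-axis. *)
Lemma enorm_row0 (x : R) : enorm (\row_i (if i == 0 then x else 0)) = `|x|.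
Proof.
by rewrite /enorm /dot !big_ord_recl big_ord0 !mxE /= mulr0 !addr0 -expr2 sqrtr_sqr.
Qed.

Lemma Lp_bound2 (q : R) (U : set (xspace R)) M (h : R -> R) (f : xspace R -> R) :
  open U -> U `<=` box2 M -> measurable_fun setT f -> locint h ->
  (forall x, `|f x| `^ q <= h x.1) -> Lp leb2 q U f.
Proof.
move=> oU UM mf lh fh; have mU := open_measurable2 oU.
split; first exact: measurable_funTS.
pose f1 := (fun x => `|f x| `^ q) \_ U.
have mfp : measurable_fun setT (fun x => `|f x| `^ q).
  exact: (measurableT_comp (measurable_normr_powR q)).
have if1 : leb2.-integrable setT (EFin \o f1).
  apply: (integrable2_le _ (proj2 lh M)).
  - by apply/(measurable_restrictT _ mU); exact: measurable_funTS.
  - move=> x _; rewrite /f1 patchE; case: ifPn => _.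
      by rewrite (ger0_norm (powR_ge0 _ _)).
    by rewrite normr0; apply: le_trans (fh x); exact: powR_ge0.
  - move=> x nx; rewrite /f1 patchE memNset//; exact: contra_not (UM x) nx.
have := integrable_lty measurableT if1; apply: le_lt_trans.
rewrite integral_mkcond le_eqVlt; apply/orP; left; apply/eqP.
by apply: eq_integral => x _; rewrite /= /f1 !patchE; case: ifP.
Qed.

Variables (p s : R).
Hypothesis p1 : 1 < p.

Let a := (p - 1)^-1.
Let alpha := 1 + a.
Let c := (p / (p - 1)) `^ (p - 1).
Let b := (p + s) / (2 * (p - 1)).
Let k := (p / (p - 1)) `^ ((p + s) / 2).

Let p1_gt0 : 0 < p - 1. Proof. by rewrite subr_gt0. Qed.
Let p1_neq0 : p - 1 != 0. Proof. by rewrite gt_eqF. Qed.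
Let a0 : 0 < a. Proof. by rewrite invr_gt0. Qed.
Let alpha0 : 0 < alpha. Proof. by rewrite addr_gt0. Qed.
Let alphaE : p / (p - 1) = alpha. Proof. by rewrite /alpha /a; field. Qed.
Let c0 : 0 < c. Proof. by rewrite /c alphaE powR_gt0. Qed.
Let k0 : 0 < k. Proof. by rewrite /k alphaE powR_gt0. Qed.

Definition example_slope (y : R) : R := alpha * spow a y.

Local Notation g := example_slope.

Lemma is_derive_example_profile (y : R) :
  is_derive y 1 (fun x => `|x| `^ (1 + (p - 1)^-1)) (g y).
Proof.
have al1 : 1 < alpha by rewrite ltrDl.
apply: (is_derive_eq (is_derive_normr_powR_gt1 y al1)).
by rewrite /example_slope (_ : alpha - 1 = a)// /alpha; ring.
Qed.

Lemma continuous_example_slope : continuous g.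
Proof.
move=> y; apply: cvgM; first exact: cvg_cst.
exact: (continuous_spow a0).
Qed.

Lemma sgrad_exampleE z :
  sgrad (example_sol p) z = \row_i (if i == 0 then g z.1.1 else 0).
Proof.
apply/rowP => i; rewrite !mxE; have [->|->] := I2_cases i.
  apply: derive_sdir0 => /=.
  have := is_deriveD (is_derive_cst (c * z.2) (z.1.1 : R) 1)
    (is_derive_example_profile z.1.1).
  by rewrite add0r.
exact: derive_sdir1_eq0.
Qed.

(** The map v |-> |v|^e v turns a signed power into a signed power.  The flux is
    the case e = p - 2 and V_s (Du) the case e = (p - 2 + s) / 2. *)
Lemma slope_powR (e y : R) :
  `|g y| `^ e * g y = alpha `^ (e + 1) * spow (a * (e + 1)) y.
Proof.
rewrite /example_slope; have [->|y0] := eqVneq y 0; first by rewrite !spow0 !mulr0.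
have ny : `|y| != 0 by rewrite normr_eq0.
rewrite normrM normr_spow// (gtr0_norm alpha0) powRM ?powR_ge0 ?ltW//.
rewrite powRD ?(gt_eqF alpha0) ?implybT// powRr1 ?ltW// -powRrM /spow.
rewrite (_ : a * (e + 1) - 1 = a * e + (a - 1)); last by ring.
by rewrite [`|y| `^ (a * e + _)]powRD ?ny ?implybT//; ring.
Qed.

(** The exponent b = a ((p-2+s)/2 + 1) equals (p+s) / (2(p-1)). *)
Lemma Vs_exampleE z :
  Vs p s (sgrad (example_sol p) z) = \row_i (if i == 0 then k * spow b z.1.1 else 0).
Proof.
rewrite sgrad_exampleE /Vs enorm_row0; apply/rowP => i; rewrite !mxE.
case: ifP => _; last by rewrite mulr0.
rewrite slope_powR /k alphaE (_ : _ / 2 + 1 = (p + s) / 2); last by field.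
by congr (_ * spow _ _); rewrite /a /b; field; rewrite p1_neq0.
Qed.

(** The exponent a (p-1) equals 1: the flux is the linear field c x_1, whose
    divergence c is the time derivative of the solution. *)
Lemma flux_exampleE z (v : 'rV[R]_2) :
  enorm (sgrad (example_sol p) z) `^ (p - 2) * dot (sgrad (example_sol p) z) v =
  c * z.1.1 * v 0 0.
Proof.
rewrite sgrad_exampleE enorm_row0 /dot !big_ord_recl big_ord0 !mxE /= mul0r !addr0.
rewrite mulrA slope_powR (_ : p - 2 + 1 = p - 1); last by ring.
rewrite mulVf// /spow subrr powRr0 mulr1 /c alphaE.
by congr (_ * _ * v _ _); apply/val_inj.
Qed.

Let V := fun z => Vs p s (sgrad (example_sol p) z).
Let N := fun z : xtspace R => (k * `|b|) * `|z.1.1| `^ (b - 1).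

Definition example_jacobian (z : xtspace R) : 'M[R]_2 :=
  \matrix_(i, j) (if (i == 0) && (j == 0) then k * (b * `|z.1.1| `^ (b - 1)) else 0).

Local Notation W := example_jacobian.

Let VE z i : V z 0 i = if i == 0 then k * spow b z.1.1 else 0.
Proof. by rewrite /V Vs_exampleE mxE. Qed.

Lemma sjac_exampleE z : z.1.1 != 0 -> sjac V z = W z.
Proof.
move=> z0; apply/matrixP => i j; rewrite !mxE.
rewrite (_ : (fun y => V y 0 i) = fun y => if i == 0 then k * spow b y.1.1 else 0);
  last by apply/funext => y; exact: VE.
have [->|->] := I2_cases j; last first.
  by rewrite andbF derive_sdir1_eq0//; case: ifP.
rewrite eqxx andbT; case: ifP => _; apply: derive_sdir0 => /=.
  exact: (is_deriveZ k (is_derive_spow b z0)).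
exact: is_derive_cst.
Qed.

Lemma frobenius_exampleE z : frobenius (W z) = N z.
Proof.
rewrite /frobenius !big_ord_recl !big_ord0 !mxE /= !expr0n /= !addr0 sqrtr_sqr.
by rewrite (normrM k) (normrM b) (ger0_norm (powR_ge0 `|z.1.1| _)) (gtr0_norm k0) mulrA.
Qed.

Lemma differentiable_Vs_example (z : xtspace R) : z.1.1 != 0 ->
  differentiable (fun x : xspace R => V (x, z.2)) z.1.
Proof.
move=> z0.
rewrite (_ : (fun x : xspace R => V (x, z.2)) =
  fun x : xspace R => (k * spow b x.1) *: (delta_mx 0 0 : 'rV[R]_2)); last first.
  apply/funext => x; apply/rowP => i; rewrite VE !mxE eqxx /=.
  by case: ifP => _; rewrite ?mulr1 ?mulr0.
apply: differentiableZl; apply: differentiableZ.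
apply: (differentiable_comp (f := fst) (g := spow b)).
  exact: differentiable_fst.
by apply/derivable1_diffP; case: (is_derive_spow b z0).
Qed.

Lemma Lp_loc_example_norm q O : 0 < q -> -1 < (b - 1) * q -> Lp_loc q O N.
Proof.
move=> q0 q1; apply: (Lp_loc_bound
  (k := fun y => (k * `|b|) `^ q * `|y| `^ ((b - 1) * q))).
- apply: measurable_funM => //; apply: (measurableT_comp (measurable_normr_powR _)).
  by apply: (measurableT_comp measurable_fst); exact: measurable_fst.
- by apply: locintZ; exact: locint_normr_powR.
- move=> z; rewrite /N ger0_norm; last by rewrite mulr_ge0 ?powR_ge0// mulr_ge0// ltW.
  by rewrite powRM ?powR_ge0 ?mulr_ge0 ?normr_ge0 ?(ltW k0)// -powRrM.
Qed.

(** The condition b > 0, that is s > -p, ensures both the continuity of spow b at 0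
    and the local integrability of its derivative. *)
Lemma singular_primitive_spow : 0 < b ->
  singular_primitive (fun y => k * spow b y) (fun y => k * (b * `|y| `^ (b - 1))).
Proof.
move=> b0; split.
- by move=> y; apply: cvgM; [exact: cvg_cst|exact: (continuous_spow b0)].
- by move=> y y0; exact: (is_deriveZ k (is_derive_spow b y0)).
- move=> y y0; apply: cvgM; first exact: cvg_cst.
  by apply: cvgM; [exact: cvg_cst|exact: continuous_normr_powR_neq0].
- by do 2 apply: locintZ; apply: locint_normr_powR; lra.
Qed.

(** Both iterated integrals equal minus the integral of c phi: the flux term by an
    integration by parts in x_1, the other one by an integration by parts in t. *)
Lemma weak_equation_example phi : test_function DT phi ->
    (\int[leb1]_(t in time_interval +oo%E) \int[leb2]_(x in [set: xspace R])
       (enorm (sgrad (example_sol p) (x, t)) `^ (p - 2)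
          * dot (sgrad (example_sol p) (x, t)) (sgrad phi (x, t)))%:E
     - \int[leb1]_(t in time_interval +oo%E) \int[leb2]_(x in [set: xspace R])
       (example_sol p (x, t) * 'D_tdir phi (x, t))%:E = 0)%E.
Proof.
move=> tphi; have [_ [K [cK KD phi0]]] := tphi.
have off z : ~ DT z -> ~ K z by move=> nD /KD.
have Dphi0 v z : ~ DT z -> 'D_v phi z = 0.
  by move=> /off; exact: derive_off_compact.
have pc : singular_primitive (fun y => c * y) (fun=> c).
  split.
  - by move=> y; apply: cvgM; [exact: cvg_cst|exact: cvg_id].
  - move=> y _; apply: (is_derive_eq (is_deriveZ c (is_derive_id y (1 : R)))).
    by rewrite /GRing.scale /= mulr1.
  - by move=> y _; exact: cvg_cst.
  - by apply: continuous_locint => y; exact: cvg_cst.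
have lu : locint (fun y : R => `|y| `^ (1 + (p - 1)^-1)).
  by apply: continuous_locint; apply: continuous_normr_powR.
have [i1 i2 e1] := integral_by_parts3_x1 cK phi0 pc (test_function_C1along _ tphi).
have [i3 i4 e2] := integral_by_parts3_t cK phi0 c lu (test_function_C1along _ tphi).
have cphi0 z : ~ DT z -> c * phi z = 0.
  by move=> /off/phi0 ->; rewrite mulr0.
have E1 : (\int[leb1]_(t in time_interval +oo%E) \int[leb2]_(x in [set: xspace R])
     (enorm (sgrad (example_sol p) (x, t)) `^ (p - 2)
        * dot (sgrad (example_sol p) (x, t)) (sgrad phi (x, t)))%:E
   = - \int[leb3]_(z in DT) (c * phi z)%:E)%E.
  have f0 z : ~ DT z -> c * z.1.1 * 'D_(sdir 0) phi z = 0.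
    by move=> nD; rewrite Dphi0// mulr0.
  transitivity (\int[leb3]_(z in DT) (c * z.1.1 * 'D_(sdir 0) phi z)%:E)%E;
    last exact: integral_opp_of_sum i1 i2 f0 cphi0 e1.
  rewrite -(integral_DT_iter i1 f0).
  apply: eq_integral => t _; apply: eq_integral => x _.
  by rewrite flux_exampleE mxE.
have E2 : (\int[leb1]_(t in time_interval +oo%E) \int[leb2]_(x in [set: xspace R])
       (example_sol p (x, t) * 'D_tdir phi (x, t))%:E
   = - \int[leb3]_(z in DT) (c * phi z)%:E)%E.
  have f0 z : ~ DT z -> example_sol p z * 'D_tdir phi z = 0.
    by move=> nD; rewrite Dphi0// mulr0.
  transitivity (\int[leb3]_(z in DT) (example_sol p z * 'D_tdir phi z)%:E)%E;
    last exact: integral_opp_of_sum i3 i4 f0 cphi0 e2.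
  exact: (integral_DT_iter i3 f0).
rewrite E1 E2; apply: subee; rewrite fin_numN.
apply: integrable_fin_num; first exact: measurable_DT.
by apply: integrableS i4 => //; exact: measurable_DT.
Qed.

Lemma weak_sjac_example : 0 < b -> weak_sjac DT V W.
Proof.
move=> b0; have pc := singular_primitive_spow b0.
have mx1 (h : R -> R) : measurable_fun setT h ->
    measurable_fun setT (fun z : xtspace R => h z.1.1).
  move=> mh; apply: (measurableT_comp mh).
  by apply: (measurableT_comp measurable_fst); exact: measurable_fst.
have lcst (r : R) : locint (fun=> r).
  by apply: continuous_locint => y; exact: cvg_cst.
split.
- move=> i; rewrite (_ : (fun z => _) =
      fun z => if i == 0 then k * spow b z.1.1 else 0); last first.
    by apply/funext => z; exact: VE.
  case: (i == 0).
    apply: (Lp_loc_bound (k := fun y => `|k * spow b y|)).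
    + apply: (mx1 (fun y => k * spow b y)); apply: measurable_funM => //.
      exact: measurable_spow.
    + apply: continuous_locint => y; apply: cvg_norm.
      by apply: cvgM; [exact: cvg_cst|exact: (continuous_spow b0)].
    + by move=> z; rewrite powRr1.
  apply: (Lp_loc_bound (k := fun=> 0)) => //.
  by move=> z; rewrite normr0 powR0.
- move=> i j; rewrite (_ : (fun z => _) = fun z => if (i == 0) && (j == 0) then
      k * (b * `|z.1.1| `^ (b - 1)) else 0); last by apply/funext => z; rewrite mxE.
  case: (_ && _).
    apply: (Lp_loc_bound (k := fun y => k * (b * `|y| `^ (b - 1)))).
    + apply: (mx1 (fun y => k * (b * `|y| `^ (b - 1)))).
      by do 2 apply: measurable_funM => //; exact: measurable_normr_powR.
    + by case: pc.
    + move=> z; rewrite powRr1 ?normr_ge0// ger0_norm//.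
      exact: mulr_ge0 (ltW k0) (mulr_ge0 (ltW b0) (powR_ge0 _ _)).
  apply: (Lp_loc_bound (k := fun=> 0)) => //.
  by move=> z; rewrite normr0 powR0.
- move=> i j phi tphi; have [_ [K [cK KD phi0]]] := tphi.
  have off z : ~ DT z -> ~ K z by move=> nD /KD.
  have Dphi0 v z : ~ DT z -> 'D_v phi z = 0.
    by move=> /off; exact: derive_off_compact.
  rewrite (eq_integral (fun z : xtspace R =>
      ((if i == 0 then k * spow b z.1.1 else 0) * 'D_(sdir j) phi z)%:E));
    last by move=> z _; rewrite VE.
  rewrite [in RHS](eq_integral (fun z : xtspace R => ((if (i == 0) && (j == 0) then
      k * (b * `|z.1.1| `^ (b - 1)) else 0) * phi z)%:E));
    last by move=> z _; rewrite mxE.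
  case: (i == 0) => /=; last first.
    by rewrite !integral0_eq ?oppe0// => z _; rewrite mul0r.
  have [->|->] := I2_cases j; last first.
    rewrite [X in (- X)%E]integral0_eq => [|z _]; last by rewrite mul0r.
    rewrite integral_vanish => [|z nD]; last by rewrite Dphi0// mulr0.
    rewrite oppe0; apply: (integral_by_parts3_x2 cK phi0 (h := fun y => k * spow b y)).
      by apply: continuous_locint; case: pc.
    exact: test_function_C1along tphi.
  have [i1 i2 e1] := integral_by_parts3_x1 cK phi0 pc (test_function_C1along _ tphi).
  apply: integral_opp_of_sum i1 i2 _ _ e1 => z nD.
    by rewrite Dphi0// mulr0.
  by rewrite phi0 ?mulr0//; exact: off.
Qed.

Lemma continuous_example_sol : continuous (example_sol p : xtspace R -> R).
Proof.
move=> z; apply: cvgD.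
  by apply: cvgM; [exact: cvg_cst|exact: cvg_snd].
apply: (continuous_x1 (h := fun y : R => `|y| `^ (1 + (p - 1)^-1))).
exact: continuous_normr_powR.
Qed.

Let p0 : 0 < p. Proof. exact: lt_trans p1. Qed.

Lemma W1p_example (U : set (xspace R)) M t : open U -> U `<=` box2 M ->
  W1p p U (fun x => example_sol p (x, t)) (fun x => sgrad (example_sol p) (x, t)).
Proof.
move=> oU UM.
have cH : continuous (fun y : R => c * t + `|y| `^ (1 + (p - 1)^-1)).
  move=> y; apply: cvgD; first exact: cvg_cst.
  exact: continuous_normr_powR.
have pH : singular_primitive (fun y : R => c * t + `|y| `^ (1 + (p - 1)^-1)) g.
  split=> //.
  - move=> y _; have := is_deriveD (is_derive_cst (c * t) y 1)
      (is_derive_example_profile y).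
    by rewrite add0r.
  - by move=> y _; exact: continuous_example_slope.
  - by apply: continuous_locint; exact: continuous_example_slope.
have mg1 (h : R -> R) : continuous h -> measurable_fun setT (fun x : xspace R => h x.1).
  move=> ch; apply: (measurableT_comp (continuous_measurable_fun ch)).
  exact: measurable_fst.
split.
- apply: (Lp_bound2 oU UM (h := fun y => `|c * t + `|y| `^ (1 + (p - 1)^-1)| `^ p)).
  + exact: (mg1 _ cH).
  + by apply: continuous_locint; exact: continuous_powR_norm.
  + by [].
- move=> i; rewrite (_ : (fun x => _) = fun x : xspace R => if i == 0 then g x.1 else 0);
    last by apply/funext => x; rewrite sgrad_exampleE mxE.
  case: (i == 0).
    apply: (Lp_bound2 oU UM (h := fun y => `|g y| `^ p)) => //.
      exact: (mg1 g continuous_example_slope).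
    apply: continuous_locint; apply: continuous_powR_norm => //.
    exact: continuous_example_slope.
  apply: (Lp_bound2 oU UM (h := fun=> 0)) => //.
    by apply: continuous_locint => y; exact: cvg_cst.
  by move=> x; rewrite normr0 powR0// gt_eqF.
- move=> i psi tpsi; have [_ [K [cK KU psi0]]] := tpsi.
  have off x : ~ U x -> ~ K x by move=> nU /KU.
  have Dpsi0 v x : ~ U x -> 'D_v psi x = 0.
    by move=> /off; exact: derive_off_compact.
  rewrite [in RHS](eq_integral (fun x : xspace R =>
      ((if i == 0 then g x.1 else 0) * psi x)%:E));
    last by move=> x _; rewrite sgrad_exampleE mxE.
  have [->|->] := I2_cases i.
    have C1 := test_function_C1along (xdir 0) tpsi; have [cpsi _ cDpsi] := C1.
    have i1 := integrable2_locint (continuous_locint cH) cDpsi cK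
      (derive_off_compact _ cK psi0).
    have [_ _ _ lg] := pH.
    have i2 := integrable2_locint lg cpsi cK psi0.
    apply: integral_opp_of_sum i1 i2 _ _ _ => [x nU|x nU|].
    + by rewrite Dpsi0// mulr0.
    + by rewrite psi0 ?mulr0//; exact: off.
    + exact: integral_by_parts2_x1 cK psi0 _ _ pH C1.
  rewrite [X in (- X)%E]integral0_eq => [|z _]; last by rewrite /= mul0r.
  rewrite integral_vanish => [|z nU]; last by rewrite Dpsi0// mulr0.
  rewrite oppe0.
  apply: (integral_by_parts2_x2 cK psi0 (continuous_locint cH)).
  exact: test_function_C1along tpsi.
Qed.

(** The cylinder lies in a box, where the example and its gradient are bounded. *)
Lemma Lp_W1p_example (U : set (xspace R)) t1 t2 : open U -> t1 < t2 ->
  compact (closure (cylinder U t1 t2)) ->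
  Lp_W1p p U t1 t2 (example_sol p) (sgrad (example_sol p)).
Proof.
move=> oU t12 /compact_coord_lt3[M [M0 KM]].
have CM : cylinder U t1 t2 `<=` box3 M.
  by move=> z /(@subset_closure _ _ z)/KM[z1 z2 z3]; split; [split|];
    rewrite /= in_itv/= -ler_norml ltW.
have UM : U `<=` box2 M.
  move=> x Ux; have /CM[] // : cylinder U t1 t2 (x, (t1 + t2) / 2).
  by split=> //=; rewrite in_itv/=; lra.
have mC : measurable (cylinder U t1 t2).
  by apply: measurableX => //; exact: open_measurable2.
have cg : continuous (fun z : xtspace R => g z.1.1).
  by apply: continuous_x1; exact: continuous_example_slope.
split.
- apply: measurable_funTS; apply: continuous_measurable3.
  exact: continuous_example_sol.
- move=> i; rewrite (_ : (fun z => _) =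
      fun z : xtspace R => if i == 0 then g z.1.1 else 0);
    last by apply/funext => z; rewrite sgrad_exampleE mxE.
  by case: (i == 0) => //; apply: measurable_funTS; exact: continuous_measurable3.
- by apply: aeW => t _; exact: W1p_example UM.
pose f (z : xtspace R) := `|example_sol p z| `^ p + `|g z.1.1| `^ p.
have cf : continuous f.
  move=> z; apply: cvgD.
    exact: (continuous_powR_norm p0 continuous_example_sol).
  exact: (continuous_powR_norm p0 cg).
pose f1 := f \_ (cylinder U t1 t2).
have /compact_bounded_norm[B HB] : compact (f @` box3 M).
  apply: continuous_compact; first exact: continuous_subspaceT.
  by apply: compact_setX; [apply: compact_setX|]; exact: segment_compact.
have if1 : leb3.-integrable setT (EFin \o f1).
  apply: (integrable3_le (k := fun=> `|B|) (M := M)).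
  - apply/(measurable_restrictT _ mC); apply: measurable_funTS.
    exact: continuous_measurable3.
  - by apply: (proj2 (continuous_locint _)) => y; exact: cvg_cst.
  - move=> z bz; rewrite /f1 patchE; case: ifPn => _; last by rewrite normr0.
    by apply: le_trans (ler_norm B); apply: HB; exists z.
  - by move=> z nz; rewrite /f1 patchE memNset//; exact: contra_not (@CM z) nz.
have := integrable_lty measurableT if1; rewrite -(integral3_iter if1); apply: le_lt_trans.
rewrite integral_mkcond le_eqVlt; apply/orP; left; apply/eqP.
apply: eq_integral => t _; rewrite patchE; case: ifPn => [tI|tI]; last first.
  apply/esym/integral0_eq => x _; rewrite /f1 patchE memNset//.
  by move: tI; rewrite notin_setE => nt [].
rewrite integral_mkcond; apply: eq_integral => x _.
rewrite /f1 !patchE; case: ifPn => xU; rewrite ?inE ?notin_setE in xU tI *.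
  by rewrite mem_set// /f sgrad_exampleE enorm_row0.
by rewrite memNset// => -[].
Qed.

Lemma weak_solution_example :
  weak_solution p [set: xspace R] +oo%E (example_sol p) (sgrad (example_sol p)).
Proof.
split=> [U t1 t2 oU t12 cC _|phi tphi]; last exact: weak_equation_example.
split; last exact: Lp_W1p_example.
by apply: continuous_subspaceT; exact: continuous_example_sol.
Qed.

Lemma no_sjac_in_L2loc : b <= 2^-1 -> ~ sjac_in_L2loc DT V.
Proof.
move=> b2 [X [[_ mX wX] [mF /(_ (st_box 1) (@compact_st_box _ _) (@st_box_sub _ _)) X2]]].
have [mX00 _] := mX 0 0.
apply: (no_L2_weak_derivative k0 b2 mX00) => [|phi tphi].
  apply: le_lt_trans X2; apply: ge0_le_integral => //.
  - exact: measurable_st_box.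
  - by move=> z _; rewrite lee_fin sqr_ge0.
  - apply/measurable_EFinP; apply: measurable_funX.
    by apply: measurable_funS mX00; [exact: measurable_DT|exact: st_box_sub].
  - apply/measurable_EFinP; apply: (measurableT_comp (measurable_normr_powR 2)).
    by apply: measurable_funS mF; [exact: measurable_DT|exact: st_box_sub].
  - move=> z _; rewrite lee_fin powR_mulrn// real_normK ?num_real//.
    rewrite /frobenius sqr_sqrtr.
      rewrite !big_ord_recl !big_ord0 !addr0 -!addrA lerDl.
      by rewrite !addr_ge0 ?sqr_ge0.
    by do 2 apply: sumr_ge0 => ? _; exact: sqr_ge0.
rewrite -(wX 0 0 phi tphi); apply: eq_integral => z _.
by rewrite VE.
Qed.

End Example.

(** * Sharpness of the range of s *)

(* D (V_s (Du)) is classical off the null set x_1 = 0.  For s = - p it vanishes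
   there, although V_s (Du) jumps across x_1 = 0, so membership in L^2_loc is
   stated for the weak derivative for all s, and also for the function
   C(p,s)|x_1|^(...) when s <> - p. *)
Theorem mainTheorem2 (R : realType) :
  exists C : R -> R -> R, forall p s : R, 1 < p ->
  let u := example_sol p in
  let V := fun z => Vs p s (sgrad u z) in
  let DT := Omega_T [set: xspace R] +oo%E in
  let N := fun z : xtspace R =>
    C p s * `|z.1.1| `^ ((- p + 2 + s) / (2 * (p - 1))) in
  [/\ weak_solution p [set: xspace R] +oo%E u (sgrad u),
      forall z, DT z -> z.1.1 != 0 ->
        differentiable (fun x : xspace R => V (x, z.2)) z.1 /\
        frobenius (sjac V z) = N z,
      - p < s -> exists W, weak_sjac DT V W /\
        (forall z, DT z -> z.1.1 != 0 -> W z = sjac V z),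
      (s != - p -> (Lp_loc 2 DT N <-> -1 < s)) /\
      (sjac_in_L2loc DT V <-> -1 < s) &
      s <= -1 -> ~ second_order_regularity p s [set: xspace R] +oo%E].
Proof.
exists (fun p s =>
  (p / (p - 1)) `^ ((p + s) / 2) * `|(p + s) / (2 * (p - 1))|) => p s p1 u V DT N.
have p1_gt0 : 0 < p - 1 by rewrite subr_gt0.
have p1_neq0 : p - 1 != 0 by rewrite gt_eqF.
set b := (p + s) / (2 * (p - 1)) in N *.
have expE : (- p + 2 + s) / (2 * (p - 1)) = b - 1 by rewrite /b; field.
have b_gt0 : - p < s -> 0 < b by move=> ps; rewrite divr_gt0; lra.
have b_le : s <= - 1 -> b <= 2^-1 by move=> s1; rewrite ler_pdivrMr; lra.
have b_gt : - 1 < s -> 2^-1 < b by move=> s1; rewrite ltr_pdivlMr; lra.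
have NE : N = fun z => (p / (p - 1)) `^ ((p + s) / 2) * `|b| * `|z.1.1| `^ (b - 1).
  by apply/funext => z; rewrite /N expE.
have wsol := weak_solution_example p1.
have L2N : -1 < s -> Lp_loc 2 DT N.
  by move=> /b_gt b2; rewrite NE; apply: Lp_loc_example_norm => //; rewrite -/b; lra.
have noL2 : s <= -1 -> ~ sjac_in_L2loc DT V.
  by move=> /b_le; exact: no_sjac_in_L2loc.
split.
- exact: wsol.
- move=> z _ z0; split; first exact: differentiable_Vs_example.
  by rewrite sjac_exampleE// frobenius_exampleE// NE.
- move=> /b_gt0 b0; exists (example_jacobian p s); split.
    exact: weak_sjac_example.
  by move=> z _ z0; rewrite sjac_exampleE.
- split=> [sp|]; split.
  + move=> LN; rewrite ltNge; apply/negP => /b_le b2.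
    apply: not_L2_power LN; last by rewrite expE; lra.
    rewrite mulf_neq0//; last first.
      rewrite normr_eq0 mulf_neq0// ?invr_eq0 ?mulf_neq0 ?pnatr_eq0//.
      by rewrite addrC addr_eq0.
    by rewrite gt_eqF// powR_gt0// divr_gt0//; lra.
  + exact: L2N.
  + by move=> LV; rewrite ltNge; apply/negP => /noL2; apply.
  + move=> s1; exists (example_jacobian p s); split.
      by apply: weak_sjac_example => //; apply: b_gt0; lra.
    rewrite (_ : (fun z => _) = N); first exact: L2N.
    by apply/funext => z; rewrite frobenius_exampleE// NE.
- by move=> /noL2 nV reg; apply: nV; exact: reg wsol.
Qed.
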